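(* For every $z\in\mathbb{D}^*=\{z\in\mathbb{C}: 0<|z|<1\}$, the limit set $\Lambda_z$ of the semigroup $G_z$ is disconnected if and only if $G_z$ is Schottky.
   Context: For $z\in\mathbb{D}^*$ let $f(x)=zx$ and $g(x)=z(x-1)+1$ be maps $\mathbb{C}\to\mathbb{C}$, and let $G_z$ be the semigroup (under composition) generated by $f$ and $g$. The limit set $\Lambda_z$ is the unique nonempty compact set $\Lambda_z\subseteq\mathbb{C}$ with $\Lambda_z=f(\Lambda_z)\cup g(\Lambda_z)$ (equivalently, the closure of the set of fixed points of elements of $G_z$). A semigroup generated by a finite set $S$ of contracting similarities is called Schottky if there is an embedded loop $\gamma\subseteq\mathbb{C}$ bounding a closed topological disk $D$ such that the elements of $S$ map $D$ to pairwise disjoint disks contained in the interior of $D$. *)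

(* Defs.v *)
(* The complex plane C is modelled as
   R * R (R : realType) with its product topology (= Euclidean topology),
   complex arithmetic written out by hand. *)
From mathcomp Require Import all_boot all_order all_algebra.
From mathcomp Require Import all_classical all_reals all_analysis.
Set Implicit Arguments. Unset Strict Implicit. Unset Printing Implicit Defensive.
Import Order.TTheory GRing.Theory Num.Theory.
Import numFieldNormedType.Exports.
Local Open Scope classical_set_scope.
Local Open Scope ring_scope.

Section Defs.
Variable R : realType.

Definition cadd (x y : R * R) : R * R := (x.1 + y.1, x.2 + y.2).
Definition csub (x y : R * R) : R * R := (x.1 - y.1, x.2 - y.2).
Definition cmul (x y : R * R) : R * R :=
  (x.1 * y.1 - x.2 * y.2, x.1 * y.2 + x.2 * y.1).
Definition cone : R * R := (1, 0).
Definition cnorm2 (x : R * R) : R := x.1 ^+ 2 + x.2 ^+ 2.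

Definition punctured_disk : set (R * R) := [set z | 0 < cnorm2 z < 1].

Definition fgen (z : R * R) (x : R * R) : R * R := cmul z x.
Definition ggen (z : R * R) (x : R * R) : R * R := cadd (cmul z (csub x cone)) cone.

(* Lambda is the limit set of G_z: the (unique) nonempty compact set with
   Lambda = f(Lambda) U g(Lambda). *)
Definition is_limit_set (z : R * R) (L : set (R * R)) : Prop :=
  L !=set0 /\ compact L /\ L = fgen z @` L `|` ggen z @` L.

Definition closed_unit_disk : set (R * R) := [set p | cnorm2 p <= 1].

(* D is a closed topological disk: the image of the closed unit disk under a
   continuous injective map (a homeomorphism onto its image, by compactness).
   Its boundary is then an embedded loop bounding D. *)
Definition closed_top_disk (D : set (R * R)) : Prop :=
  exists phi : R * R -> R * R,
    {within closed_unit_disk, continuous phi} /\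
    (forall p q, closed_unit_disk p -> closed_unit_disk q -> phi p = phi q -> p = q) /\
    D = phi @` closed_unit_disk.

Definition schottky (z : R * R) : Prop :=
  exists D : set (R * R),
    closed_top_disk D /\
    fgen z @` D `<=` interior D /\
    ggen z @` D `<=` interior D /\
    fgen z @` D `&` ggen z @` D = set0.

End Defs.

(* Main.v *)
(** If [f(L)] and [g(L)] meet, short chains of points of [L] exist at every scale
and [L] is connected.  Otherwise let [delta > 0] be the distance of [f(L)] and
[g(L)].  Iterating the two contractions shows that any two points of [L] are
joined by a chain in [L] with steps at most [delta], so that the
neighbourhoods [K] and [U] of [L] of radii slightly larger than [delta / 2] are
connected, while [f(U)] and [g(U)] are disjoint and contained in [K].

A closed topological disk [D] is then squeezed between [K] and the filling of
[U], the set of points that no unbounded connected set avoiding [U] contains.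
Take the cells of a fine hexagonal tiling that meet [K] and fill the holes of
their union.  A finite set of cells that is connected and has connected
complement is the image of one hexagon by a homeomorphism of the plane: one can
remove a boundary cell that does not disconnect it, by a discrete Jordan
theorem the remaining neighbours of that cell form an arc of its boundary, and
the cell is put back by explicit piecewise linear pushes.

Every point outside the interior of [D] can escape to infinity there, so [f(D)]
and [g(D)] lie in the interior of [D].  They lie in the fillings of the disjoint
connected sets [f(U)] and [g(U)], which are either nested or disjoint; nested
fillings are impossible because [g(U)] is a translate of [f(U)]. *)

Require Import Defs.
From mathcomp Require Import all_boot all_order all_algebra.
From mathcomp Require Import all_classical all_reals all_analysis.
From mathcomp Require Import ring lra zify.
Import Order.TTheory GRing.Theory Num.Theory.
Import numFieldNormedType.Exports.
Local Open Scope classical_set_scope.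
Local Open Scope ring_scope.
Set Implicit Arguments.
Unset Strict Implicit.
Unset Printing Implicit Defensive.

(** * Continuous functions *)

(** The overview treats one implication. For the converse, a Schottky disk [D] contains [L]: a point
    of [L] is an image of [L] under arbitrarily long words in the two maps, and these words preserve
    [D] while contracting distances to it. Hence [f(L)] and [g(L)] are disjoint, and they split [L]
    into two closed pieces.

    The main obstacle is planar topology. A neighbourhood of [L] may have holes, and turning its
    filling into a disk would ordinarily call for the Jordan and Schoenflies theorems. In a
    hexagonal tiling any two cells that touch share a side, so one adjacency relation governs both a
    set of cells and its complement, and the topology becomes combinatorial. Inside and outside are
    never read off from a curve: the outside of [V] consists of the points lying in an unbounded
    connected set that avoids [V], a notion that homeomorphisms transport.

    The radius of [U] has to exceed half a step, so that balls around consecutive points of a chain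
    overlap, yet after contraction it may not exceed half the distance of [f(L)] and [g(L)]. Both
    hold for a suitable radius because [|z| < 1]. All lengths are squared in the code, so these
    bounds appear as [delta / 4]. *)

Definition cont (T U : topologicalType) (f : T -> U) : Prop := continuous f.

Section Cont.
Variables (R : realType) (T : topologicalType).
Implicit Types f g : T -> R.

Lemma cont_cst (c : R) : cont (fun _ : T => c).
Proof. by move=> x; exact: cvg_cst. Qed.

Lemma cont_id : cont (fun x : T => x).
Proof. by move=> x; exact: cvg_id. Qed.

Lemma cont_add f g : cont f -> cont g ->
  cont (fun x => f x + g x).
Proof. by move=> cf cg x; apply: cvgD; [exact: cf|exact: cg]. Qed.

Lemma cont_opp f : cont f -> cont (fun x => - f x).
Proof. by move=> cf x; apply: cvgN; exact: cf. Qed.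

Lemma cont_mul f g : cont f -> cont g ->
  cont (fun x => f x * g x).
Proof. by move=> cf cg x; apply: cvgM; [exact: cf|exact: cg]. Qed.

Lemma cont_exp f n : cont f -> cont (fun x => f x ^+ n).
Proof.
move=> cf; elim: n => [|n IH]; first exact: cont_cst.
rewrite (_ : (fun x => _) = (fun x => f x * f x ^+ n)).
  exact: cont_mul.
by apply/funext => x; rewrite exprS.
Qed.

Lemma cont_norm f : cont f -> cont (fun x => `|f x|).
Proof. by move=> cf x; apply: cvg_norm; exact: cf. Qed.

Lemma cont_max f g : cont f -> cont g ->
  cont (fun x => Num.max (f x) (g x)).
Proof.
move=> cf cg.
rewrite (_ : (fun x => _) = (fun x => (f x + g x + `|f x - g x|) / 2)).
  apply: cont_mul; last exact: cont_cst.
  apply: cont_add; first exact: cont_add.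
  by apply: cont_norm; apply: cont_add => //; exact: cont_opp.
by apply/funext => x; rewrite maxr_absE.
Qed.

Lemma cont_min f g : cont f -> cont g ->
  cont (fun x => Num.min (f x) (g x)).
Proof.
move=> cf cg.
rewrite (_ : (fun x => _) = (fun x => (f x + g x - `|f x - g x|) / 2)).
  apply: cont_mul; last exact: cont_cst.
  apply: cont_add; first exact: cont_add.
  by apply/cont_opp/cont_norm/cont_add => //; exact: cont_opp.
by apply/funext => x; rewrite minr_absE.
Qed.

Lemma cont_inv f : (forall x, f x != 0) -> cont f ->
  cont (fun x => (f x)^-1).
Proof. by move=> f0 cf x; apply: cvgV => //; exact: cf. Qed.

Lemma cont_pair (U V : topologicalType) (f : T -> U) (g : T -> V) :
  cont f -> cont g -> cont (fun x => (f x, g x)).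
Proof. by move=> cf cg x; apply: cvg_pair; [exact: cf|exact: cg]. Qed.

End Cont.

Lemma cont_comp (S T U : topologicalType) (g : T -> U) (f : S -> T) :
  cont g -> cont f -> cont (fun x => g (f x)).
Proof. by move=> cg cf x; apply: continuous_comp; [exact: cf|exact: cg]. Qed.

Lemma cont_fst (T U : topologicalType) : cont (fun x : T * U => x.1).
Proof. by move=> x; exact: cvg_fst. Qed.

Lemma cont_snd (T U : topologicalType) : cont (fun x : T * U => x.2).
Proof. by move=> x; exact: cvg_snd. Qed.

(* Syntax-directed: plain [apply] would try to unify up to conversion. *)
Ltac continuity :=
  lazymatch goal with
  | |- cont (fun x => @?f x + @?g x) => refine (@cont_add _ _ f g _ _); continuity
  | |- cont (fun x => - @?f x) => refine (@cont_opp _ _ f _); continuity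
  | |- cont (fun x => @?f x * @?g x) => refine (@cont_mul _ _ f g _ _); continuity
  | |- cont (fun x => @?f x ^+ ?n) => refine (@cont_exp _ _ f n _); continuity
  | |- cont (fun x => `|@?f x|) => refine (@cont_norm _ _ f _); continuity
  | |- cont (fun x => Num.max (@?f x) (@?g x)) => refine (@cont_max _ _ f g _ _); continuity
  | |- cont (fun x => Num.min (@?f x) (@?g x)) => refine (@cont_min _ _ f g _ _); continuity
  | |- cont (fun x => (@?f x, @?g x)) => refine (@cont_pair _ _ _ f g _ _); continuity
  | |- cont (fun x => fst x) => exact: cont_fst
  | |- cont (fun x => snd x) => exact: cont_snd
  | |- cont (fun x => x) => exact: cont_id
  | |- _ => first [assumption | exact: cont_cst]
  end.

(** * Local moves of the plane *)

Ltac conj_lra := repeat (apply/andP; split); lra.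

Section Kite.
Variable R : realType.
Implicit Types (w t : R) (p : R * R).

(* The increasing piecewise linear bijection fixing everything outside
   [- w < t < 2 w] and sending 0 to w, and its inverse. *)
Definition kup w t := t + Num.max 0 (Num.min (t + w) ((2 * w - t) / 2)).
Definition kdn w t := t - Num.max 0 (Num.min ((t + w) / 2) (2 * w - t)).

Ltac no_minmax a :=
  lazymatch a with
  | context [Num.max _ _] => fail
  | context [Num.min _ _] => fail
  | _ => idtac
  end.

Ltac split_minmax :=
  repeat match goal with
  | |- context [Num.max ?a ?b] => no_minmax a; no_minmax b; case: (lerP a b) => ?
  | |- context [Num.min ?a ?b] => no_minmax a; no_minmax b; case: (lerP a b) => ?
  end.

Lemma kupK w : cancel (kup w) (kdn w).
Proof. by move=> t; rewrite /kup /kdn; split_minmax; lra. Qed.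

Lemma kdnK w : cancel (kdn w) (kup w).
Proof. by move=> t; rewrite /kup /kdn; split_minmax; lra. Qed.

Lemma kup_out w t : ~~ (- w < t < 2 * w) -> kup w t = t.
Proof.
rewrite negb_and -!leNgt => /orP[] ?; rewrite /kup; split_minmax; lra.
Qed.

(** Applied on each line in the direction of a push: lying on one side of 0 before the push means
    lying on the same side of [w] after it. For [w <= 0] the interval is empty and [kup w] is the
    identity, so pushes fade out where the width vanishes. *)
Lemma kup_in w t : - w < t < 2 * w ->
  [/\ - w < kup w t < 2 * w, (0 <= t) = (w <= kup w t) &
      (t <= 0) = (kup w t <= w)].
Proof.
move=> /andP[? ?]; split; rewrite /kup.
- by split_minmax; apply/andP; split; lra.
- by apply/idP/idP; split_minmax; lra.
- by apply/idP/idP; split_minmax; lra.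
Qed.

End Kite.

Section LocalMoves.
Variable R : realType.
Implicit Types (p : R * R) (b e : seq bool).

Definition homeo (h : R * R -> R * R) : Prop :=
  cont h /\ exists h' : R * R -> R * R,
    [/\ cont h', cancel h h' & cancel h' h].

Lemma homeo_comp h k : homeo h -> homeo k -> homeo (fun p => h (k p)).
Proof.
move=> [ch [h' [ch' hK h'K]]] [ck [k' [ck' kK k'K]]]; split.
  exact: cont_comp.
exists (fun p => k' (h' p)); split; first exact: cont_comp.
- by move=> p; rewrite hK kK.
- by move=> p; rewrite k'K h'K.
Qed.

Definition sector (m : nat) p : bool :=
  match m with
  | 0 => 0 <= p.2 <= p.1
  | 1 => 0 <= p.1 <= p.2
  | 2 => p.1 <= 0 <= p.2
  | 3 => p.1 <= p.2 <= 0
  | 4 => p.2 <= p.1 <= 0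
  | _ => p.2 <= 0 <= p.1
  end.

(** On [sector m] this is the hexagonal norm, the maximum of [|x|], [|y|] and [|x - y|]. *)
Definition height (m : nat) p : R :=
  match m with
  | 0 => p.1
  | 1 => p.2
  | 2 => p.2 - p.1
  | 3 => - p.1
  | 4 => - p.2
  | _ => p.1 - p.2
  end.

(** The open hexagon of radius 2: of a whole tiling it meets only the central cell and its six
    neighbours, so moves supported there see nothing else. *)
Definition near2 p : bool :=
  [&& -2 < p.1 < 2, -2 < p.2 < 2 & -2 < p.1 - p.2 < 2].

(* The plane is cut into the six triangles of a hexagon and the six truncated
   sectors outside it; [b] and [e] list the triangles and sectors present. *)
Definition config b e p : bool :=
  has (fun m => sector m p && (nth false b m && (height m p <= 1)
                            || nth false e m && (1 <= height m p))) (iota 0 6).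

Arguments config : simpl never.

Lemma configP b e p : reflect
  (exists2 m, (m < 6)%N & sector m p /\
     (nth false b m && (height m p <= 1) || nth false e m && (1 <= height m p)))
  (config b e p).
Proof.
apply: (iffP hasP) => [[m]|[m m6 [sm hm]]].
  by rewrite mem_iota => m6 /andP[sm hm]; exists m.
by exists m; [rewrite mem_iota|rewrite sm hm].
Qed.

Definition local_homeo h : Prop :=
  [/\ homeo h, forall p, ~~ near2 p -> h p = p & forall p, near2 p -> near2 (h p)].

(** The pattern [e] stays fixed: it stands for the neighbouring cells, while the triangles of the
    central cell are switched one at a time. *)
Definition step b e b' : Prop := exists2 h, local_homeo h &
  forall p, config b e p = config b' e (h p).

Lemma local_homeo_inv h : local_homeo h ->
  exists2 h', local_homeo h' & cancel h h' /\ cancel h' h.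
Proof.
move=> [[ch [h' [ch' hK h'K]]] hout hin]; exists h' => //; split.
- by split=> //; exists h; split.
- by move=> p np; rewrite -{1}(hout p np) hK.
- move=> p np; apply: contraT => nh.
  by move: (nh); rewrite -(hout _ nh) h'K np.
Qed.

Lemma step_sym b e b' : step b e b' -> step b' e b.
Proof.
move=> [h /local_homeo_inv[h' lh' [hK h'K]] hQ]; exists h' => // p.
by rewrite hQ h'K.
Qed.

Lemma step_trans b2 b1 e b3 : step b1 e b2 -> step b2 e b3 -> step b1 e b3.
Proof.
move=> [h [hh hout hin] hQ] [k [kh kout kin] kQ].
exists (fun p => k (h p)); last by move=> p; rewrite hQ kQ.
split; first exact: homeo_comp.
- by move=> p np; rewrite (hout _ np) kout.
- by move=> p np; apply/kin/hin.
Qed.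

(** A sixth of a turn in the skew coordinates. It sends each sector to the next, so that every move
    need only be built at triangle 0. *)
Definition rho p : R * R := (p.1 - p.2, p.1).
Definition rho' p : R * R := (p.2, p.2 - p.1).

Lemma rhoK : cancel rho rho'.
Proof. by move=> [x y]; congr pair => /=; lra. Qed.

Lemma rho'K : cancel rho' rho.
Proof. by move=> [x y]; congr pair => /=; lra. Qed.

Lemma homeo_rho : homeo rho.
Proof.
split; first by rewrite /rho /rho'; continuity.
by exists rho'; split; [by rewrite /rho /rho'; continuity|exact: rhoK|exact: rho'K].
Qed.

Lemma homeo_rho' : homeo rho'.
Proof.
split; first by rewrite /rho /rho'; continuity.
by exists rho; split; [by rewrite /rho /rho'; continuity|exact: rho'K|exact: rhoK].
Qed.

Lemma near2_rho p : near2 (rho p) = near2 p.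
Proof.
by case: p => x y; rewrite /near2/=; apply/idP/idP=> /and3P[/andP[? ?] /andP[? ?] /andP[? ?]];
  apply/and3P; split; apply/andP; split; lra.
Qed.

Lemma config_rho b e p : size b = 6 -> size e = 6 ->
  config b e (rho p) = config (rot 1 b) (rot 1 e) p.
Proof.
case: b => [|b0 [|b1 [|b2 [|b3 [|b4 [|b5 [|]]]]]]] // _.
case: e => [|e0 [|e1 [|e2 [|e3 [|e4 [|e5 [|]]]]]]] // _.
case: p => x y.
have E m : (m < 6)%N -> sector (m.+1 %% 6) (rho (x, y)) = sector m (x, y)
  /\ height (m.+1 %% 6) (rho (x, y)) = height m (x, y).
  by case: m => [|[|[|[|[|[|]]]]]] // _; rewrite /rho /=; split;
    try (by lra); apply/idP/idP=> /andP[? ?]; apply/andP; split; lra.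
apply/configP/configP => -[m m6 [sm hm]].
- exists ((m + 5) %% 6)%N; first by rewrite ltn_mod.
  have [] := E ((m + 5) %% 6)%N _; first by rewrite ltn_mod.
  have -> : (((m + 5) %% 6).+1 %% 6 = m)%N by lia.
  move=> <- <-; split=> //.
  by move: m m6 hm {sm} => [|[|[|[|[|[|]]]]]].
- have [Es Eh] := E m m6.
  exists ((m.+1) %% 6)%N; first by rewrite ltn_mod.
  rewrite Es Eh; split=> //.
  by move: m m6 hm {sm Es Eh} => [|[|[|[|[|[|]]]]]].
Qed.

Lemma step_rot b e b' : size b = 6 -> size e = 6 -> size b' = 6 ->
  step (rot 1 b) (rot 1 e) (rot 1 b') -> step b e b'.
Proof.
move=> sb se sb' [h [hh hout hin] hQ].
exists (fun p => rho (h (rho' p))).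
  split.
  - by apply: homeo_comp; [exact: homeo_rho|apply: homeo_comp => //; exact: homeo_rho'].
  - move=> p np; rewrite hout ?rho'K //.
    by rewrite -near2_rho rho'K.
  - by move=> p np; rewrite near2_rho; apply: hin; rewrite -near2_rho rho'K.
by move=> p; rewrite config_rho // -hQ -config_rho // rho'K.
Qed.

(* Pushes the midpoint of the edge from 0 to (1, 0) to the vertex (1, 1). *)
Definition widthA p : R := 1 - `|2 * p.1 - 1 - p.2|.
Definition pushA p : R * R :=
  let d := kup (widthA p) p.2 - p.2 in (p.1 + d / 2, p.2 + d).
Definition pullA p : R * R :=
  let d := kdn (widthA p) p.2 - p.2 in (p.1 + d / 2, p.2 + d).

(** The push runs in the direction [(1/2, 1)], and [2 * p.1 - 1 - p.2] is constant on such lines.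
    The map is therefore [kup] with a fixed width on each line, and its inverse is found line by
    line. *)
Lemma widthA_push p : widthA (pushA p) = widthA p.
Proof. by rewrite /widthA /pushA /=; congr (1 - `|_|); field. Qed.
Lemma widthA_pull p : widthA (pullA p) = widthA p.
Proof. by rewrite /widthA /pullA /=; congr (1 - `|_|); field. Qed.

Lemma pushA2 p : (pushA p).2 = kup (widthA p) p.2.
Proof. by rewrite /pushA /=; ring. Qed.
Lemma pullA2 p : (pullA p).2 = kdn (widthA p) p.2.
Proof. by rewrite /pullA /=; ring. Qed.

Lemma pushAK : cancel pushA pullA.
Proof.
move=> [x y]; rewrite {1}/pullA widthA_push pushA2 kupK.
by rewrite /pushA; congr pair => /=; field.
Qed.

Lemma pullAK : cancel pullA pushA.
Proof.
move=> [x y]; rewrite {1}/pushA widthA_pull pullA2 kdnK.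
by rewrite /pullA; congr pair => /=; field.
Qed.

Lemma homeo_pushA : homeo pushA.
Proof.
split; first by rewrite /pushA /kup /widthA; continuity.
exists pullA; split; [|exact: pushAK|exact: pullAK].
by rewrite /pullA /kdn /widthA; continuity.
Qed.

(* Pushes the centre 0 to the midpoint of the edge from (1, 0) to (1, 1). *)
Definition widthB p : R := 1 - `|2 * p.2 - p.1|.
Definition pushB p : R * R :=
  let d := 1 - p.1 - kdn (widthB p) (1 - p.1) in (p.1 + d, p.2 + d / 2).
Definition pullB p : R * R :=
  let d := 1 - p.1 - kup (widthB p) (1 - p.1) in (p.1 + d, p.2 + d / 2).

Lemma widthB_push p : widthB (pushB p) = widthB p.
Proof. by rewrite /widthB /pushB /=; congr (1 - `|_|); field. Qed.
Lemma widthB_pull p : widthB (pullB p) = widthB p.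
Proof. by rewrite /widthB /pullB /=; congr (1 - `|_|); field. Qed.

Lemma pushB1 p : 1 - (pushB p).1 = kdn (widthB p) (1 - p.1).
Proof. by rewrite /pushB /=; ring. Qed.
Lemma pullB1 p : 1 - (pullB p).1 = kup (widthB p) (1 - p.1).
Proof. by rewrite /pullB /=; ring. Qed.

Lemma pushBK : cancel pushB pullB.
Proof.
move=> [x y]; rewrite {1}/pullB widthB_push pushB1 kdnK.
by rewrite /pushB; congr pair => /=; field.
Qed.

Lemma pullBK : cancel pullB pushB.
Proof.
move=> [x y]; rewrite {1}/pushB widthB_pull pullB1 kupK.
by rewrite /pullB; congr pair => /=; field.
Qed.

Lemma homeo_pullB : homeo pullB.
Proof.
split; first by rewrite /pullB /kup /widthB; continuity.
exists pushB; split; [|exact: pullBK|exact: pushBK].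
by rewrite /pushB /kdn /widthB; continuity.
Qed.

Lemma local_homeo_kite (kite : pred (R * R)) h : homeo h ->
  (forall p, kite p -> near2 p) -> (forall p, ~~ kite p -> h p = p) ->
  (forall p, kite p -> kite (h p)) -> local_homeo h.
Proof.
move=> hh kn hout hin; split=> // p np.
- by apply: hout; apply: contra np; exact: kn.
- have [kp|nk] := boolP (kite p); last by rewrite hout.
  by apply/kn/hin.
Qed.

Ltac in_sector m := apply/configP; exists m => //=; split; first (by conj_lra).
Ltac config_cases := move=> /configP[[|[|[|[|[|[|//]]]]]] _ /= [/andP[? ?]]].
Ltac cells H tac :=
  lazymatch type of H with
  | is_true (_ || _) => case/orP: H => H; cells H tac
  | is_true (_ && _) => let H' := fresh in case/andP: H => H' H; cells H tac
  | is_true false => discriminate H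
  | _ => tac
  end.
Ltac by_cells tac := let H := fresh in intro H; cells H tac.

(* Unlike [lerP], does not search the goal for comparisons. *)
Lemma le_or_lt (u v : R) : u <= v \/ v < u.
Proof. by case: lerP; [left|right]. Qed.

(** Triangle 0 changes colour when the edge that it shares with triangle 5 is swept across it onto
    its two other edges. The kite of the push starts in triangle 5 and extends beyond triangle 0
    into triangle 1 and the outer sectors 0 and 1, which is why these must have colour [c]; the
    other entries are free. *)
Lemma stepA (c b2 b3 b4 e2 e3 e4 e5 : bool) :
  step [:: c; c; b2; b3; b4; ~~ c] [:: c; c; e2; e3; e4; e5]
       [:: ~~ c; c; b2; b3; b4; ~~ c].
Proof.
pose kite p := - widthA p < p.2 < 2 * widthA p.
have kiteE x y : kite (x, y) = [&& 0 < x, x < 1 + y, 4 * x < 4 + y & 3 * y < 4 * x].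
  rewrite /kite /widthA /=; case: (ger0P (2 * x - 1 - y)) => ?.
    by apply/andP/and4P => [[? ?]|[? ? ? ?]]; split; lra.
  by apply/andP/and4P => [[? ?]|[? ? ? ?]]; split; lra.
have hout p : ~~ kite p -> pushA p = p.
  by move=> nk; rewrite /pushA kup_out // subrr mul0r !addr0; case: p {nk}.
have hin p : kite p -> kite (pushA p).
  by move=> /kup_in[K _ _]; rewrite /kite widthA_push pushA2.
exists pushA.
  apply: (local_homeo_kite homeo_pushA) hout hin.
  by move=> [x y]; rewrite kiteE /near2 /= => /and4P[? ? ? ?]; conj_lra.
move=> p; have [kp|nk] := boolP (kite p); last first.
  rewrite (hout _ nk); case: p nk => x y; rewrite kiteE => nk.
  (* The kite covers triangle 0 except the two fixed ends of the pushed edge. Each of these also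
     belongs to a closed piece that is present both before and after, so switching the triangle does
     not affect them. *)
  have T0 : 0 <= y <= x -> x <= 1 -> x = 0 /\ y = 0 \/ x = 1 /\ y = 0.
    move=> /andP[? ?] ?; case: (lerP x 0) => ?; first by left; split; lra.
    case: (lerP (1 + y) x) => ?; first by right; split; lra.
    by exfalso; move/negP: nk; apply; apply/and4P; split; lra.
  have aux c1 c2 : c1 = ~~ c2 ->
      config [:: c1; c; b2; b3; b4; ~~ c] [:: c; c; e2; e3; e4; e5] (x, y) ->
      config [:: c2; c; b2; b3; b4; ~~ c] [:: c; c; e2; e3; e4; e5] (x, y).
    move=> Ec /configP[[|m] m6 [/= sm hm]]; last by apply/configP; exists m.+1.
    have [x1|x1] := le_or_lt x 1; last first.
      have cT : c by case/orP: hm => /andP[? ?] //; lra.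
      by apply/configP; exists 0%N => //=; rewrite cT sm; split=> //; apply/orP; right; lra.
    have [[-> ->]|[-> ->]] := T0 sm x1.
      have [cT|cF] := boolP c; apply/configP.
        by exists 1%N => //=; rewrite !lexx ler01.
      by exists 5%N => //=; rewrite !lexx subrr ler01.
    have [cT|cF] := boolP c; apply/configP.
      by exists 0%N => //=; rewrite !lexx ler01 orbT.
    by exists 5%N => //=; rewrite !lexx ler01 subr0 lexx.
  by apply/idP/idP; apply: aux; rewrite ?negbK.
have K2 : (0 <= p.2) = (widthA (pushA p) <= (pushA p).2) /\
          (p.2 <= 0) = ((pushA p).2 <= widthA (pushA p)).
  by have [_ ? ?] := kup_in kp; rewrite widthA_push pushA2.
have Q1 q : kite q -> config [:: c; c; b2; b3; b4; ~~ c] [:: c; c; e2; e3; e4; e5] q =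
    (if c then 0 <= q.2 else q.2 <= 0).
  case: q => x y; rewrite kiteE => /and4P[? ? ? ?] /=; clear K2 kp hin hout p.
  case: c; apply/idP/idP.
  - by config_cases; by_cells ltac:(lra).
  - move=> ?; have [?|?] := le_or_lt y x.
      in_sector 0%N; have [?|?] := le_or_lt x 1; apply/orP; [left|right]; lra.
    in_sector 1%N; have [?|?] := le_or_lt y 1; apply/orP; [left|right]; lra.
  - by config_cases; by_cells ltac:(lra).
  - by move=> ?; in_sector 5%N; apply/orP; left; lra.
have Q2 q : kite q -> config [:: ~~ c; c; b2; b3; b4; ~~ c] [:: c; c; e2; e3; e4; e5] q =
    (if c then widthA q <= q.2 else q.2 <= widthA q).
  case: q => x y; rewrite kiteE => /and4P[? ? ? ?] /=; clear Q1 K2 kp hin hout p.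
  have W1 : (widthA (x, y) <= y) = (1 <= x) || (x <= y).
    rewrite /widthA /=; case: (ger0P (2 * x - 1 - y)) => ?; apply/idP/orP => [?|[] ?]; try lra;
      by have [?|?] := le_or_lt 1 x; [left|right; lra].
  have W2 : (y <= widthA (x, y)) = (x <= 1) && (y <= x).
    rewrite /widthA /=; case: (ger0P (2 * x - 1 - y)) => ?; apply/idP/andP => [?|[? ?]]; try split; lra.
  rewrite W1 W2; case: c; apply/idP/idP.
  - by config_cases; by_cells ltac:(first [exfalso; lra | apply/orP; (have [?|?] := le_or_lt 1 x; [left|right]); lra]).
  - move=> H; have [?|?] := le_or_lt x y.
      in_sector 1%N; have [?|?] := le_or_lt y 1; apply/orP; [left|right]; lra.
    by in_sector 0%N; case/orP: H; lra.
  - by config_cases; by_cells ltac:(conj_lra).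
  - move=> /andP[? ?]; have [?|?] := le_or_lt 0 y.
      by in_sector 0%N; rewrite ?orbF; lra.
    by in_sector 5%N; apply/orP; left; lra.
rewrite (Q1 _ kp) (Q2 _ (hin _ kp)); by case: K2 => -> ->.
Qed.

(** The midpoint of the outer edge of triangle 0 is pulled to the centre, so that the piece of
    colour [c] beyond this edge swallows the triangle. With [c = true] this starts the filling of an
    empty hexagon; with [c = false], read backwards, it fills the last triangle. *)
Lemma stepB (c e1 e2 e3 e4 e5 : bool) :
  step (nseq 6 (~~ c)) [:: c; e1; e2; e3; e4; e5] (c :: nseq 5 (~~ c)).
Proof.
pose kite p := - widthB p < 1 - p.1 < 2 * widthB p.
have kiteE x y : kite (x, y) = [&& y < 1, x < 1 + y, 4 * y < 1 + 3 * x & x < 1 + 4 * y].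
  rewrite /kite /widthB /=; case: (ger0P (2 * y - x)) => ?.
    by apply/andP/and4P => [[? ?]|[? ? ? ?]]; split; lra.
  by apply/andP/and4P => [[? ?]|[? ? ? ?]]; split; lra.
have hout p : ~~ kite p -> pullB p = p.
  by move=> nk; rewrite /pullB kup_out // subrr mul0r !addr0; case: p {nk}.
have hin p : kite p -> kite (pullB p).
  by move=> /kup_in[K _ _]; rewrite /kite widthB_pull pullB1.
exists pullB.
  apply: (local_homeo_kite homeo_pullB) hout hin.
  by move=> [x y]; rewrite kiteE /near2 /= => /and4P[? ? ? ?]; conj_lra.
move=> p; have [kp|nk] := boolP (kite p); last first.
  rewrite (hout _ nk); case: p nk => x y; rewrite kiteE => nk.
  have T0 : 0 <= y <= x -> x <= 1 -> x = 1 /\ y = 0 \/ x = 1 /\ y = 1.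
    move=> /andP[? ?] ?.
    case: (lerP (1 + y) x) => ?; first by left; split; lra.
    case: (lerP (1 + 4 * y) x) => ?; first by left; split; lra.
    case: (lerP 1 y) => ?; first by right; split; lra.
    case: (lerP (1 + 3 * x) (4 * y)) => ?; first by right; split; lra.
    by exfalso; move/negP: nk; apply; apply/and4P; split.
  have aux c1 c2 : c1 = ~~ c2 ->
      config (c1 :: nseq 5 (~~ c)) [:: c; e1; e2; e3; e4; e5] (x, y) ->
      config (c2 :: nseq 5 (~~ c)) [:: c; e1; e2; e3; e4; e5] (x, y).
    move=> Ec /configP[[|m] m6 [/= sm hm]]; last by apply/configP; exists m.+1.
    have [x1|x1] := le_or_lt x 1; last first.
      have cT : c by case/orP: hm => /andP[? ?] //; lra.
      by apply/configP; exists 0%N => //=; rewrite cT sm; split=> //; apply/orP; right; lra.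
    have [[-> ->]|[-> ->]] := T0 sm x1.
      have [cT|cF] := boolP c; apply/configP.
        by exists 0%N => //=; rewrite !lexx ler01 orbT.
      by exists 5%N => //=; rewrite !lexx ler01 subr0 lexx.
    have [cT|cF] := boolP c; apply/configP.
      by exists 0%N => //=; rewrite !lexx ler01 orbT.
    by exists 1%N => //=; rewrite !lexx ler01.
  by apply/idP/idP; apply: (aux _ _ _); rewrite ?negbK.
have K2 : (0 <= 1 - p.1) = (widthB (pullB p) <= 1 - (pullB p).1) /\
          (1 - p.1 <= 0) = (1 - (pullB p).1 <= widthB (pullB p)).
  by have [_ ? ?] := kup_in kp; rewrite widthB_pull pullB1.
have Q1 q : kite q -> config (nseq 6 (~~ c)) [:: c; e1; e2; e3; e4; e5] q =
    (if c then 1 - q.1 <= 0 else 0 <= 1 - q.1).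
  case: q => x y; rewrite kiteE => /and4P[? ? ? ?] /=; clear K2 kp hin hout p.
  case: c; apply/idP/idP.
  - by config_cases; by_cells ltac:(lra).
  - by move=> ?; in_sector 0%N; lra.
  - by config_cases; by_cells ltac:(lra).
  - move=> ?; have [?|?] := le_or_lt 0 y; have [?|?] := le_or_lt 0 x; have [?|?] := le_or_lt x y.
    + by in_sector 1%N; apply/orP; left; lra.
    + by in_sector 0%N; rewrite orbF; lra.
    + by in_sector 2%N; apply/orP; left; lra.
    + by exfalso; lra.
    + by exfalso; lra.
    + by in_sector 5%N; apply/orP; left; lra.
    + by in_sector 3%N; apply/orP; left; lra.
    + by in_sector 4%N; apply/orP; left; lra.
have Q2 q : kite q -> config (c :: nseq 5 (~~ c)) [:: c; e1; e2; e3; e4; e5] q =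
    (if c then 1 - q.1 <= widthB q else widthB q <= 1 - q.1).
  case: q => x y; rewrite kiteE => /and4P[? ? ? ?] /=; clear Q1 K2 kp hin hout p.
  have W1 : (1 - x <= widthB (x, y)) = (0 <= y) && (y <= x).
    rewrite /widthB /=; case: (ger0P (2 * y - x)) => ?; apply/idP/andP => [?|[? ?]]; try split; lra.
  have W2 : (widthB (x, y) <= 1 - x) = (y <= 0) || (x <= y).
    rewrite /widthB /=; case: (ger0P (2 * y - x)) => ?; apply/idP/orP => [?|[] ?]; try lra;
      by have [?|?] := le_or_lt y 0; [left|right; lra].
  rewrite W1 W2; case: c; apply/idP/idP.
  - by config_cases; by_cells ltac:(first [exfalso; lra | conj_lra]).
  - move=> /andP[? ?]; in_sector 0%N; have [?|?] := le_or_lt x 1; apply/orP; [left|right]; lra.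
  - by config_cases; by_cells ltac:(first [exfalso; lra | apply/orP; left; lra | apply/orP; right; lra]).
  - move=> xy; have [?|?] := le_or_lt 0 y; have [?|?] := le_or_lt 0 x; have [?|?] := le_or_lt x y.
    + by in_sector 1%N; apply/orP; left; lra.
    + by in_sector 5%N; apply/orP; left; case/orP: xy; lra.
    + by in_sector 2%N; apply/orP; left; lra.
    + by exfalso; lra.
    + by exfalso; lra.
    + by in_sector 5%N; apply/orP; left; lra.
    + by in_sector 3%N; apply/orP; left; lra.
    + by in_sector 4%N; apply/orP; left; lra.
rewrite (Q1 _ kp) (Q2 _ (hin _ kp)); by case: K2 => -> ->.
Qed.

End LocalMoves.

(** * Chains of hexagonal cells *)

Definition cell : Type := (int * int)%type.

Definition dir (m : nat) : cell :=
  match m with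
  | 0 => (1, 0) | 1 => (1, 1) | 2 => (0, 1)
  | 3 => (-1, 0) | 4 => (-1, -1) | _ => (0, -1)
  end.

Definition nbr (c : cell) (m : nat) : cell := (c.1 + (dir m).1, c.2 + (dir m).2).

Definition adj (c d : cell) : bool := has (fun m => d == nbr c m) (iota 0 6).

Lemma adjP c d : reflect (exists2 m, (m < 6)%N & d = nbr c m) (adj c d).
Proof.
apply: (iffP hasP) => [[m]|[m m6 ->]]; first by rewrite mem_iota => m6 /eqP; exists m.
by exists m; rewrite ?mem_iota.
Qed.

Lemma adj_nbr c m : (m < 6)%N -> adj c (nbr c m).
Proof. by move=> m6; apply/adjP; exists m. Qed.

Lemma nbr_opp c m : (m < 6)%N -> nbr (nbr c m) ((m + 3) %% 6) = c.
Proof.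
by case: c => i j; move: m => [|[|[|[|[|[|//]]]]]] _; congr pair => /=; lia.
Qed.

Lemma adj_sym : symmetric adj.
Proof.
move=> c d; apply/adjP/adjP => -[m m6 ->];
  by exists ((m + 3) %% 6)%N; rewrite ?nbr_opp // ltn_mod.
Qed.

Lemma nbr_neq c m : nbr c m != c.
Proof.
case: c => i j; apply/eqP => -[].
by move: m => [|[|[|[|[|]]]]] /=; lia.
Qed.

Section Chains.
Variable T : eqType.
Variable r : rel T.
Implicit Types A B : pred T.

Definition joined A (x y : T) : Prop :=
  exists p, [/\ path r x p, last x p = y & all A (x :: p)].

Definition joined_set A : Prop := forall x y, A x -> A y -> joined A x y.

Lemma joined_refl A x : A x -> joined A x x.
Proof. by move=> Ax; exists [::]; split=> //=; rewrite Ax. Qed.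

Lemma joined_trans A y x z : joined A x y -> joined A y z -> joined A x z.
Proof.
move=> [p [rp lp Axp]] [q [rq lq Ayq]].
exists (p ++ q); split; rewrite ?cat_path ?last_cat ?lp ?rp //.
by rewrite -cat_cons all_cat Axp; case/andP: Ayq.
Qed.

Lemma joined1 A x y : A x -> A y -> r x y -> joined A x y.
Proof. by move=> Ax Ay rxy; exists [:: y]; split=> //=; rewrite ?rxy ?Ax ?Ay. Qed.

Lemma joined_sub A B x y : (forall z, A z -> B z) -> joined A x y -> joined B x y.
Proof.
move=> AB [p [rp lp Ap]]; exists p; split=> //.
by apply: sub_all Ap => z; exact: AB.
Qed.

Lemma joined_mem A x y : joined A x y -> A x /\ A y.
Proof.
move=> [p [_ <- Ap]]; split; first by case/andP: Ap.
exact: (allP Ap _ (mem_last _ _)).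
Qed.

Lemma joined_sym A x y : symmetric r -> joined A x y -> joined A y x.
Proof.
move=> rs [p []]; elim: p x => [|z p IH] x /= .
  by move=> _ <- /andP[Ax _]; exact: joined_refl.
move=> /andP[rxz rp] lp /andP[Ax Ap].
apply: (@joined_trans _ z); first exact: IH.
by apply: joined1; rewrite // 1?rs //; case/andP: Ap.
Qed.

Lemma joined_reach A x y : joined A x y ->
  joined (fun w => `[< joined A x w >]) x y.
Proof.
move=> [p [rp lp Ap]]; exists p; split=> //; apply/allP => w wp; apply/asboolP.
case/splitPl: wp rp Ap {lp} => p1 p2 lp1.
rewrite cat_path -cat_cons all_cat => /andP[rp1 _] /andP[Ap1 _].
by exists p1.
Qed.

Lemma joined_exit A B x y : joined A x y -> B x -> ~~ B y ->
  exists u v, [/\ joined (predI A B) x u, r u v, A v & ~~ B v].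
Proof.
move=> [p []]; elim: p x => [|z p IH] x /=.
  by move=> _ <- _ Bx; rewrite Bx.
move=> /andP[rxz rp] lp /andP[Ax Ap] Bx nBy.
have Az : A z by case/andP: Ap.
have [Bz|nBz] := boolP (B z); last first.
  by exists x, z; split=> //; apply: joined_refl; apply/andP.
have [u [v [zu ruv Av nBv]]] := IH z rp lp Ap Bz nBy.
exists u, v; split=> //; apply: joined_trans zu.
by apply: joined1 => //; apply/andP.
Qed.

End Chains.

Lemma count_lt (T : eqType) (P Q : pred T) (s : seq T) c :
  (forall u, P u -> Q u) -> c \in s -> Q c -> ~~ P c -> (count P s < count Q s)%N.
Proof.
move=> PQ; elim: s => //= a s IH; rewrite inE => /predU1P[<-|cs] Qc nPc.
  by rewrite Qc (negbTE nPc) add0n add1n ltnS; apply: sub_count.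
rewrite -addnS leq_add ?IH //.
by case: (boolP (P a)) => // /PQ->.
Qed.

Lemma exists_max_fst (s : seq cell) (x : cell) : x \in s ->
  exists2 c, c \in s & forall d, d \in s -> d.1 <= c.1.
Proof.
elim: s x => // a s IH x _.
case: s IH => [|b s] IH.
  by exists a; rewrite ?mem_head // => d; rewrite inE => /eqP->.
have [c cs cm] := IH b (mem_head _ _).
have [ac|ac] := lerP a.1 c.1.
  exists c; first by rewrite inE cs orbT.
  by move=> d; rewrite inE => /predU1P[->|/cm].
exists a; first exact: mem_head.
by move=> d; rewrite inE => /predU1P[->|/cm dc] //; apply: le_trans dc (ltW ac).
Qed.

(* A cell with maximal first coordinate has two neighbours outside. *)
Lemma exposed_cell (s : seq cell) x y : x \in s ->
  exists c m, [/\ c \in s, (m < 6)%N, nbr c m \notin s & nbr c m != y].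
Proof.
move=> /exists_max_fst[c cs cm]; exists c.
have out m : (dir m).1 = 1 -> nbr c m \notin s.
  by move=> dm; apply/negP => /cm; rewrite /= dm; lia.
have [E|E] := eqVneq (nbr c 0) y.
  exists 1%N; split=> //; first exact: out.
  by rewrite -E; apply/eqP => -[]; lia.
by exists 0%N; split=> //; exact: out.
Qed.

(** Induction on the number of cells of [s] outside [R c], the component of [y] once the boundary
    cell [c] is deleted. If [R c] misses part of [t c], an exposed cell [c'] of the missed part is a
    better choice: its component contains [R c] and also [c]. The complement stays connected because
    the deleted cell has a neighbour outside [s]. *)
Lemma removable_cell (s : seq cell) (y x : cell) :
  joined_set adj (fun z => z \in s) -> joined_set adj (fun z => z \notin s) ->
  y \in s -> x \in s -> x != y ->
  exists c, [/\ c \in s, joined_set adj (fun z => z \in seq.filter (predC1 c) s) &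
    joined_set adj (fun z => z \notin seq.filter (predC1 c) s)].
Proof.
move=> js jc ys xs xy.
pose t c := seq.filter (predC1 c) s.
have tE c z : (z \in t c) = (z != c) && (z \in s) by rewrite mem_filter.
pose R c z := `[< joined adj (fun z => z \in t c) y z >].
have good c : c \in s -> c != y -> (exists2 m, (m < 6)%N & nbr c m \notin s) ->
    (forall z, z \in t c -> R c z) ->
    exists c, [/\ c \in s, joined_set adj (fun z => z \in t c) & joined_set adj (fun z => z \notin t c)].
  move=> cs cy [m m6 nm] Rc; exists c; split=> //.
  - move=> u v /Rc/asboolP yu /Rc/asboolP yv.
    by apply: joined_trans yv; apply: joined_sym => //; exact: adj_sym.
  - have sub z : z \notin s -> z \notin t c.
      by rewrite tE => /negbTE->; rewrite andbF.
    have tc : c \notin t c by rewrite /= tE eqxx.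
    have toc z : z \notin t c -> joined adj (fun z => z \notin t c) z c.
      rewrite tE negb_and negbK => /orP[/eqP->|nz]; first exact: joined_refl.
      apply: (@joined_trans _ _ _ (nbr c m)).
        by apply: joined_sub sub _; apply: jc.
      apply: joined1 => //; first by apply: sub.
      by rewrite adj_sym; exact: adj_nbr.
    move=> u v Pu Pv; apply: joined_trans (toc _ Pu) _.
    by apply: joined_sym; [exact: adj_sym|exact: toc].
suff main n c : c \in s -> c != y -> (exists2 m, (m < 6)%N & nbr c m \notin s) ->
    (count (fun z => ~~ R c z) s <= n)%N ->
    exists c, [/\ c \in s, joined_set adj (fun z => z \in t c) & joined_set adj (fun z => z \notin t c)].
  have xt : x \in t y by rewrite tE xy.
  have [c [m [ct m6 nt ny]]] := exposed_cell y xt.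
  move: ct nt; rewrite !tE ny /= => /andP[cy cs] ns.
  by apply: (main _ c) (leqnn _) => //; exists m.
elim: n c => [|n IH] c cs cy ex.
  rewrite leqn0 -/(count _ _) => /eqP c0; apply: (good c) => // z.
  rewrite tE => /andP[_ zs]; apply: contraT => nR.
  by move/eqP: c0; rewrite -leqn0 leqNgt -has_count; case/hasP; exists z.
move=> cn.
have [/allP all_R|] := boolP (all (R c) (t c)); first exact: (good c).
rewrite -has_predC => /hasP[z zt nRz].
pose X := seq.filter (predC (R c)) (t c).
have zX : z \in X by rewrite mem_filter nRz.
have [c' [m [cX m6 nX nc]]] := exposed_cell c zX.
move: cX; rewrite mem_filter /= tE => /and3P[nRc' c'c c's].
have yt : y \in t c by rewrite tE eq_sym cy.
have Ry : R c y by apply/asboolP; exact: joined_refl.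
have c'y : c' != y by apply: contraNneq nRc' => ->.
(* A neighbour in [s] other than [c] lies in [X] or in [R c]. The first is excluded by exposure, the
   second would put [c'] itself into [R c]. *)
have ns : nbr c' m \notin s.
  apply: contra nX => ns; rewrite mem_filter /= tE nc ns !andbT.
  apply: contra nRc' => /asboolP yn; apply/asboolP; apply: (joined_trans yn).
  apply: joined1; rewrite ?tE ?nc ?c'c //.
  by rewrite adj_sym; exact: adj_nbr.
apply: (IH c') => //; first by exists m.
(* Deleting [c'] enlarges the component of [y] at least by [c]. *)
have grow u : R c u -> R c' u.
  move=> /asboolP/joined_reach cu; apply/asboolP; apply: joined_sub cu => w Rw.
  have /joined_mem[_] := asboolW Rw; rewrite !tE => /andP[_ ->]; rewrite andbT.
  by apply: contraNneq nRc' => <-.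
have Rc : R c' c.
  have [u [v [yu ruv vs nv]]] : exists u v, [/\ joined adj (predI (fun z => z \in s) (predC1 c)) y u,
      adj u v, v \in s & ~~ (predC1 c) v].
    by apply: (@joined_exit _ adj (fun z => z \in s) (predC1 c) y c); [exact: js|rewrite /= eq_sym|rewrite /= eqxx].
  have {nv} E : v = c by move: nv; rewrite /= negbK => /eqP.
  have Ru : R c u.
    by apply/asboolP; apply: joined_sub yu => w /andP[ws wc]; rewrite tE; apply/andP.
  apply/asboolP; have /asboolP yu' := grow _ Ru.
  apply: (joined_trans yu'); have [_ ut] := joined_mem yu'.
  by apply: joined1; rewrite // ?tE -?E // ?E eq_sym c'c.
rewrite -ltnS; apply: leq_trans cn; apply: (@count_lt _ _ _ _ c) => //.
- by move=> u; apply: contra; exact: grow.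
- by apply/negP => /asboolP/joined_mem[_]; rewrite tE eqxx.
- by rewrite Rc.
Qed.

(** * A discrete Jordan curve theorem *)

Section WalkParity.
Implicit Types (f g : cell -> cell -> bool) (x : cell) (p : seq cell).

Fixpoint walk_xor f x p : bool :=
  if p is y :: q then f x y (+) walk_xor f y q else false.

Lemma eq_walk_xor f g x p : (forall s s', adj s s' -> f s s' = g s s') ->
  path adj x p -> walk_xor f x p = walk_xor g x p.
Proof.
by move=> fg; elim: p x => //= y p IH x /andP[/fg-> /IH->].
Qed.

Lemma walk_xorD f g x p :
  walk_xor (fun s s' => f s s' (+) g s s') x p = walk_xor f x p (+) walk_xor g x p.
Proof. by elim: p x => //= y p IH x; rewrite IH addbACA. Qed.

Lemma walk_xor_telescope (r : pred cell) x p :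
  walk_xor (fun s s' => r s (+) r s') x p = r x (+) r (last x p).
Proof.
by elim: p x => [|y p IH] x /=; rewrite ?addbb // IH addbA addbK.
Qed.

Lemma walk_xor_cat f x p q :
  walk_xor f x (p ++ q) = walk_xor f x p (+) walk_xor f (last x p) q.
Proof. by elim: p x => //= y p IH x; rewrite IH addbA. Qed.

Lemma walk_xor0 f x p : (forall s s', s \in x :: p -> s' \in x :: p -> f s s' = false) ->
  walk_xor f x p = false.
Proof.
elim: p x => //= y p IH x f0; rewrite f0 ?mem_head // ?inE ?eqxx ?orbT // IH //.
by move=> s s' sp s'p; rewrite f0 // inE ?sp ?s'p orbT.
Qed.

End WalkParity.

Definition is_edge (a b s s' : cell) : bool :=
  (s == a) && (s' == b) || (s == b) && (s' == a).

(* The triangle [(true, c)] has vertices c, c + (1, 0), c + (1, 1), the triangle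
   [(false, c)] has vertices c, c + (0, 1), c + (1, 1); [crosses t s s'] tells
   whether the edge s s' meets the horizontal ray going right from inside t. *)
Definition crosses (t : bool * cell) (s s' : cell) : bool :=
  let: (up, (i, j)) := t in
  if up then
    [&& s.2 == j, s'.2 == j + 1 & i + 1 <= s.1]
    || [&& s'.2 == j, s.2 == j + 1 & i + 1 <= s'.1]
  else
    [&& s.2 == j, s'.2 == j + 1 & i + 1 <= s'.1]
    || [&& s'.2 == j, s.2 == j + 1 & i + 1 <= s.1].

(** The triangles of the dual triangulation in cyclic order around [c]: number [m] has the corners
    [c], [nbr c m] and the next neighbour of [c]. *)
Definition triangle (m : nat) (c : cell) : bool * cell :=
  match m with
  | 0 => (true, c)
  | 1 => (false, c)
  | 2 => (true, (c.1 - 1, c.2))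
  | 3 => (false, (c.1 - 1, c.2 - 1))
  | 4 => (true, (c.1 - 1, c.2 - 1))
  | _ => (false, (c.1, c.2 - 1))
  end.

Lemma addr_eql (u v : int) : (u + v == u) = (v == 0).
Proof. by lia. Qed.

(* Only the coordinates of s relative to (i, j) matter, and the second one only
   if it is -1, 0 or 1. *)
Ltac crosses_cases b :=
  move=> [|[|[|[|[|[|//]]]]]] _ ->;
  rewrite /is_edge /crosses /nbr /= !xpair_eqE /= -?addrA;
  rewrite ?(lerD2l, inj_eq (addrI _), addr_eql);
  (case: (eqVneq b 0) => [->|?] /=; last
    (case: (eqVneq b 1) => [->|?] /=; last case: (eqVneq b (-1)) => [->|?] /=));
  rewrite ?addr0 ?subr0; lia.

Lemma cell_relative (i j : int) (s : cell) : exists a b, s = (i + a, j + b).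
Proof.
by exists (s.1 - i), (s.2 - j); rewrite [LHS]surjective_pairing; congr pair; lia.
Qed.

Lemma crosses_diag i j s s' : adj s s' ->
  crosses (false, (i, j)) s s' =
  crosses (true, (i, j)) s s' (+) is_edge (i, j) (i + 1, j + 1) s s'.
Proof. by have [a [b ->]] := cell_relative i j s; case/adjP; crosses_cases b. Qed.

Lemma crosses_vert i j s s' : adj s s' ->
  crosses (true, (i, j)) s s' =
  crosses (false, (i + 1, j)) s s' (+) is_edge (i + 1, j) (i + 1, j + 1) s s'.
Proof. by have [a [b ->]] := cell_relative i j s; case/adjP; crosses_cases b. Qed.

(** Here the two rays lie in different rows. Apart from the common edge, their crossings differ by
    the change of an indicator, that of the cells of row [j] to the right of [i]; this telescopes to
    zero along a closed walk. *)
Lemma crosses_horiz i j s s' : adj s s' ->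
  crosses (true, (i, j)) s s' (+) crosses (false, (i, j - 1)) s s' =
  is_edge (i, j) (i + 1, j) s s' (+)
  (((s.2 == j) && (i + 1 <= s.1)) (+) ((s'.2 == j) && (i + 1 <= s'.1))).
Proof. by have [a [b ->]] := cell_relative i j s; case/adjP; crosses_cases b. Qed.

(** The triangles [m - 1] and [m] around [c] (indices mod 6) are the two sides of the edge from [c]
    to [nbr c m]. *)
Lemma parity_turn x p c m : path adj x p -> last x p = x -> (m < 6)%N ->
  walk_xor (crosses (triangle m c)) x p (+)
  walk_xor (crosses (triangle ((m + 5) %% 6) c)) x p =
  walk_xor (is_edge c (nbr c m)) x p.
Proof.
move=> xp lp; have edgeC a b s s' : is_edge a b s s' = is_edge b a s s'.
  by rewrite /is_edge orbC.
case: c => i j; move: m => [|[|[|[|[|[|//]]]]]] _ /=.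
- rewrite -walk_xorD (eq_walk_xor (@crosses_horiz i j) xp) walk_xorD.
  rewrite (walk_xor_telescope (fun s => (s.2 == j) && (i + 1 <= s.1))) lp addbb addbF.
  by apply: eq_walk_xor xp => s s' _; rewrite /nbr /= addr0.
- rewrite (eq_walk_xor (@crosses_diag i j) xp) walk_xorD addbC addKb.
  exact: eq_walk_xor xp.
- rewrite (eq_walk_xor (@crosses_vert (i - 1) j) xp) walk_xorD subrK addbC addKb.
  by apply: eq_walk_xor xp => s s' _; rewrite /nbr /= addr0.
- rewrite addbC -walk_xorD (eq_walk_xor (@crosses_horiz (i - 1) j) xp) walk_xorD.
  rewrite (walk_xor_telescope (fun s => (s.2 == j) && (i - 1 + 1 <= s.1))) lp addbb addbF.
  by apply: eq_walk_xor xp => s s' _; rewrite /nbr /= addr0 subrK edgeC.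
- rewrite addbC (eq_walk_xor (@crosses_diag (i - 1) (j - 1)) xp) walk_xorD addbC addKb.
  by apply: eq_walk_xor xp => s s' _; rewrite /nbr /= !subrK edgeC.
- rewrite addbC (eq_walk_xor (@crosses_vert (i - 1) (j - 1)) xp) walk_xorD !subrK addbC addKb.
  by apply: eq_walk_xor xp => s s' _; rewrite /nbr /= addr0 edgeC.
Qed.

Lemma triangle_nbr c m : (m < 6)%N -> triangle ((m + 2) %% 6) (nbr c m) = triangle m c.
Proof.
by case: c => i j; move: m => [|[|[|[|[|[|//]]]]]] _;
  rewrite /triangle /nbr /=; congr (_, (_, _)); lia.
Qed.

Lemma parity_off_walk x p c m : path adj x p -> last x p = x -> c \notin x :: p ->
  (m < 6)%N ->
  walk_xor (crosses (triangle m c)) x p = walk_xor (crosses (triangle 0 c)) x p.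
Proof.
move=> xp lp cp; elim: m => // m IH m6.
have xor0 (a b : bool) : a (+) b = false -> a = b by case: a; case: b.
rewrite -IH ?(ltnW m6) //; apply: xor0.
have := parity_turn c xp lp m6; rewrite (_ : ((m.+1 + 5) %% 6 = m)%N); last by lia.
move=> ->; apply: walk_xor0 => s s' sp s'p.
rewrite /is_edge; apply: contraNF cp.
by case/orP=> /andP[/eqP E /eqP E']; rewrite -?E -?E'.
Qed.

Lemma parity_joined x p a b : path adj x p -> last x p = x ->
  joined adj (fun z => z \notin x :: p) a b ->
  walk_xor (crosses (triangle 0 a)) x p = walk_xor (crosses (triangle 0 b)) x p.
Proof.
move=> xp lp [q []]; elim: q a => [|a' q IH] a /=; first by move=> _ ->.
move=> /andP[/adjP[m m6 ->] qp] lq /and3P[ap a'p qa].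
rewrite -(parity_off_walk xp lp ap m6) -triangle_nbr //.
rewrite parity_off_walk //; last by rewrite ltn_mod.
by apply: IH => //=; rewrite a'p.
Qed.

Lemma interleave_parity a1 b1 a2 b2 :
  (a1 < b1 < a2)%N -> (a2 < b2)%N || (b2 < a1)%N ->
  (0 < a1 <= b1)%N (+) (0 < a2 <= b1)%N != (0 < a1 <= b2)%N (+) (0 < a2 <= b2)%N.
Proof.
move=> /andP[ab ba].
have -> : (0 < a1 <= b1)%N = (0 < a1)%N by rewrite (ltnW ab) andbT.
have -> : (0 < a2 <= b1)%N = false by rewrite (leqNgt a2) ba andbF.
have a20 : (0 < a2)%N by apply: leq_ltn_trans ba.
rewrite a20 addbF; case/orP => h.
  by rewrite (ltnW (ltn_trans (ltn_trans ab ba) h)) (ltnW h) andbT; case: (0 < a1)%N.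
rewrite (leqNgt a1) (leqNgt a2) h (ltn_trans h (ltn_trans ab ba)) !andbF.
by rewrite (leq_ltn_trans _ h).
Qed.

(* The crossing parity of the walk closed up through [c] is constant along the
   chain in [B], but changes twice around [c]: at [nbr c a1] and [nbr c a2]. *)
Lemma joined_noncrossing (A B : pred cell) c a1 a2 b1 b2 :
  (forall z, A z -> ~~ B z) -> ~~ A c -> ~~ B c ->
  joined adj A (nbr c a1) (nbr c a2) -> joined adj B (nbr c b1) (nbr c b2) ->
  (a2 < 6)%N -> (b2 < 6)%N -> (a1 < b1 < a2)%N -> (a2 < b2)%N || (b2 < a1)%N -> False.
Proof.
move=> AB nAc nBc [q [qp lq Aq]] jB a26 b26 /andP[a1b1 b1a2] sep.
pose p := nbr c a1 :: rcons q c.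
have a16 : (a1 < 6)%N by lia.
have b16 : (b1 < 6)%N by lia.
have xp : path adj c p.
  rewrite /p /= adj_nbr //= rcons_path qp /= lq adj_sym; exact: adj_nbr.
have lp : last c p = c by rewrite /p /= last_rcons.
have walkA z : z \in c :: p -> z = c \/ A z.
  rewrite /p !inE mem_rcons inE => /or3P[/eqP->|/eqP->|/predU1P[->|zq]]; try by left.
    by right; case/andP: Aq.
  by right; case/andP: Aq => _ /allP; apply.
have joff : joined adj (fun z => z \notin c :: p) (nbr c b1) (nbr c b2).
  apply: joined_sub jB => z Bz; apply/negP => /walkA[E|/AB]; last by rewrite Bz.
  by rewrite -E Bz in nBc.
have [off1 off2] := joined_mem joff.
have mult m : (m < 6)%N -> walk_xor (is_edge c (nbr c m)) c p = (m == a1) (+) (m == a2).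
  move=> m6; have cn k : (c == nbr c k) = false by rewrite eq_sym; apply/negbTE/nbr_neq.
  have nc k : (nbr c k == c) = false by apply/negbTE/nbr_neq.
  have inj k : (k < 6)%N -> (nbr c k == nbr c m) = (m == k).
    move=> k6; apply/eqP/eqP => [|->] //.
    case: c {xp lp walkA joff off1 off2 cn nc jB Aq lq qp p nAc nBc} => i j [].
    by move: m k m6 k6 => [|[|[|[|[|[|//]]]]]] [|[|[|[|[|[|//]]]]]] _ _ //=; lia.
  rewrite /p /= /is_edge eqxx inj // cn /= orbF -cats1 walk_xor_cat /=.
  rewrite lq eqxx inj // nc /= addbF walk_xor0 ?andbT // => s s' sq s'q.
  apply/negbTE; apply: contra nAc.
  by case/orP => /andP[/eqP E /eqP E'];
    [rewrite -E|rewrite -E']; apply: (allP Aq).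
pose f m := walk_xor (crosses (triangle m c)) c p.
(* The parity flips on passing the neighbours [a1] and [a2]. The edge towards [nbr c 0] separates
   triangles 5 and 0 and is not passed on the way from 0 up to [m], whence the condition [0 < a]. *)
have fE m : (m < 6)%N -> f m = f 0%N (+) ((0 < a1 <= m)%N (+) (0 < a2 <= m)%N).
  elim: m => [|m IH] m6; first by case: (a1) => [|?]; case: (a2) => [|?] //=; rewrite addbF.
  have := parity_turn c xp lp m6; rewrite (_ : ((m.+1 + 5) %% 6 = m)%N); last by lia.
  rewrite mult // -/(f m) -/(f m.+1) IH ?(ltnW m6) // => E.
  have -> : f m.+1 = (m.+1 == a1) (+) (m.+1 == a2) (+)
      (f 0%N (+) ((0 < a1 <= m)%N (+) (0 < a2 <= m)%N)) by rewrite -E addbK.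
  have S a : (0 < a <= m.+1)%N = (m.+1 == a) (+) (0 < a <= m)%N.
    by rewrite (leq_eqVlt a) ltnS [m.+1 == a]eq_sym; case: eqVneq => // ->; rewrite ltnn andbF.
  by rewrite !S [X in _ = _ (+) X]addbACA [RHS]addbCA.
have := parity_joined xp lp joff.
(* Triangle [b1] around [c] is triangle [b1 + 2] around [nbr c b1]. As that neighbour is off the
   walk, its parity may be read at this triangle, where it is [f b1]; likewise for [b2]. *)
rewrite -(parity_off_walk xp lp off1 (m := (b1 + 2) %% 6)) ?ltn_mod //.
rewrite -(parity_off_walk xp lp off2 (m := (b2 + 2) %% 6)) ?ltn_mod //.
rewrite (triangle_nbr c b16) (triangle_nbr c b26) -/(f b1) -/(f b2) (fE _ b16) (fE _ b26) => /addbI/eqP.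
by apply/negP; apply: interleave_parity => //; rewrite a1b1.
Qed.

Definition arc6 (r k : nat) : seq bool := rot r (nseq k true ++ nseq (6 - k) false).

(** The hypotheses are turned into boolean tests, and the 64 cyclic words of length 6 are checked by
    computation. *)
Lemma arc6P (e : seq bool) : size e = 6 ->
  (exists2 m, (m < 6)%N & nth false e m) -> (exists2 m, (m < 6)%N & ~~ nth false e m) ->
  (forall a1 b1 a2 b2, (a2 < 6)%N -> (b2 < 6)%N -> (a1 < b1 < a2)%N ->
     (a2 < b2)%N || (b2 < a1)%N -> nth false e a1 -> nth false e a2 ->
     nth false e b1 || nth false e b2) ->
  exists r k, [/\ (r < 6)%N, (0 < k < 6)%N & e = arc6 r k].
Proof.
move=> se et ef noalt.
pose noaltb (e : seq bool) := all (fun a1 => all (fun b1 => all (fun a2 => all (fun b2 =>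
  ((a1 < b1 < a2) && ((a2 < b2) || (b2 < a1)))%N ==> nth false e a1 ==> nth false e a2
  ==> (nth false e b1 || nth false e b2)) (iota 0 6)) (iota 0 6)) (iota 0 6)) (iota 0 6).
pose isarc (e : seq bool) := has (fun r => has (fun k => e == arc6 r k) (iota 1 5)) (iota 0 6).
have : isarc e.
  have {noalt} : noaltb e.
    apply/allP => a1 _; apply/allP => b1 _; apply/allP => a2; rewrite mem_iota => a26.
    apply/allP => b2; rewrite mem_iota => b26; apply/implyP => /andP[ab sep].
    by apply/implyP => ea1; apply/implyP => ea2; exact: (noalt a1 b1 a2 b2).
  have {et} : has id e.
    by case: et => m m6 em; apply/hasP; exists (nth false e m) => //; rewrite mem_nth ?se.
  have {ef} : ~~ all id e.
    case: ef => m m6 em; rewrite -has_predC; apply/hasP.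
    by exists (nth false e m) => //; rewrite mem_nth ?se.
  case: e se => [|e0 [|e1 [|e2 [|e3 [|e4 [|e5 [|]]]]]]] // _.
  by case: e0; case: e1; case: e2; case: e3; case: e4; case: e5; vm_compute.
case/hasP => r; rewrite mem_iota => r6 /hasP[k]; rewrite mem_iota => k6 /eqP eE.
by exists r, k; split=> //; lia.
Qed.

(** * Filling the holes of a set of cells *)

Lemma joined_row (P : pred cell) i i' j : (forall k, P (k, j)) ->
  joined adj P (i, j) (i', j).
Proof.
move=> Pj; have step k n : joined adj P (k, j) (k + n%:Z, j).
  elim: n => [|n IH]; first by rewrite addr0; exact: joined_refl.
  apply: joined_trans IH _; apply: joined1 => //.
  by apply/adjP; exists 0%N => //; congr pair => /=; lia.
have [le|/ltW le] := lerP i i'.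
  by have := step i `|i' - i|%N; rewrite (_ : i + _ = i') //; lia.
apply: joined_sym; first exact: adj_sym.
by have := step i' `|i - i'|%N; rewrite (_ : i' + _ = i) //; lia.
Qed.

Lemma joined_column (P : pred cell) i j j' : (forall k, P (i, k)) ->
  joined adj P (i, j) (i, j').
Proof.
move=> Pj; have step k n : joined adj P (i, k) (i, k + n%:Z).
  elim: n => [|n IH]; first by rewrite addr0; exact: joined_refl.
  apply: joined_trans IH _; apply: joined1 => //.
  by apply/adjP; exists 2%N => //; congr pair => /=; lia.
have [le|/ltW le] := lerP j j'.
  by have := step j `|j' - j|%N; rewrite (_ : j + _ = j') //; lia.
apply: joined_sym; first exact: adj_sym.
by have := step j' `|j - j'|%N; rewrite (_ : j' + _ = j) //; lia.
Qed.

Definition in_box (m : nat) (c : cell) : bool := (`|c.1| < m)%N && (`|c.2| < m)%N.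

Definition box_cells (m : nat) : seq cell :=
  [seq (i%:Z - m%:Z, j%:Z - m%:Z) | i <- iota 0 (2 * m), j <- iota 0 (2 * m)].

Lemma mem_box m c : in_box m c -> c \in box_cells m.
Proof.
case: c => i j /andP[/= im jm]; apply/allpairsP.
exists (absz (i + m%:Z), absz (j + m%:Z)); split; rewrite ?mem_iota /=; try lia.
by congr pair; lia.
Qed.

Lemma joined_far (Y : pred cell) m c d : (forall c, Y c -> in_box m c) ->
  ~~ in_box m c -> ~~ in_box m d -> joined adj (predC Y) c d.
Proof.
move=> Ym; have out z : ~~ in_box m z -> predC Y z by apply: contra; exact: Ym.
have row i j : (m <= `|j|)%N -> joined adj (predC Y) (i, j) (m%:Z, j).
  by move=> jm; apply: joined_row => k; apply: out; rewrite negb_and /= -!leqNgt jm orbT.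
have col i j : (m <= `|i|)%N -> joined adj (predC Y) (i, j) (i, m%:Z).
  by move=> im; apply: joined_column => k; apply: out; rewrite negb_and /= -!leqNgt im.
have toc z : ~~ in_box m z -> joined adj (predC Y) z (m%:Z, m%:Z).
  case: z => i j; rewrite negb_and /= -!leqNgt => /orP[im|jm].
    by apply: joined_trans (col i j im) (row i m _).
  by apply: joined_trans (row i j jm) (col m j _).
move=> cm dm; apply: joined_trans (toc c cm) _.
by apply: joined_sym; [exact: adj_sym|exact: toc].
Qed.

(** [s] is [Y] together with its holes: the cells that no chain off [Y] joins to the corner
    [(m, m)], a cell just outside the box. *)
Lemma fill_cells (Y : pred cell) m y0 : Y y0 -> (forall c, Y c -> in_box m c) ->
  joined_set adj Y ->
  exists s : seq cell,
    [/\ forall c, Y c -> c \in s, joined_set adj (fun c => c \in s),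
        joined_set adj (fun c => c \notin s) &
        forall c d, c \in s -> ~~ in_box m d -> ~ joined adj (predC Y) c d].
Proof.
move=> Y0 Ym jY.
pose b : cell := (m%:Z, m%:Z).
have bm : ~~ in_box m b by rewrite /in_box /= ltnn.
pose E c := `[< joined adj (predC Y) b c >].
pose s := seq.filter (predC E) (box_cells m).
have EC c : E c -> c \notin s by move=> Ec; rewrite mem_filter /= Ec.
have sE c : (c \in s) = ~~ E c.
  rewrite mem_filter /=; have [Ec|nE] //= := boolP (E c).
  apply: mem_box; apply: contraNT nE => cm.
  by apply/asboolP; exact: joined_far cm.
have sY c : Y c -> c \in s.
  by move=> Yc; rewrite sE; apply/negP => /asboolP/joined_mem[_] /=; rewrite Yc.
exists s; split=> //.
- (* The chain from a cell of [s] to infinity meets [Y] before leaving [s]. *)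
  have toY c : c \in s -> exists2 y, Y y & joined adj (fun c => c \in s) c y.
    move=> cs; have [Yc|nYc] := boolP (Y c); first by exists c => //; exact: joined_refl.
    have all_c : joined adj predT c y0.
      case: c {cs nYc} => i j; case: y0 {Y0} => i0 j0.
      by apply: (@joined_trans _ _ _ (i0, j)); [apply: joined_row|apply: joined_column].
    have nY0 : ~~ predC Y y0 by rewrite /= negbK.
    have [u [v [cu uv _ /negPn Yv]]] := joined_exit all_c nYc nY0.
    have reach_s w : joined adj (predC Y) c w -> w \in s.
      move=> cw; rewrite sE; apply/negP => /asboolP bw; move: cs; rewrite sE => /negP; apply.
      by apply/asboolP; apply: joined_trans bw _; apply: joined_sym => //; exact: adj_sym.
    have {}cu : joined adj (predC Y) c u by apply: joined_sub cu => z /andP[].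
    exists v => //; apply: (@joined_trans _ _ _ u).
      by apply: joined_sub (joined_reach cu) => z /asboolP; exact: reach_s.
    by apply: joined1 => //; [exact: reach_s|exact: sY].
  move=> c d /toY[y Yy cy] /toY[y' Yy' dy'].
  apply: joined_trans cy _; apply: (@joined_trans _ _ _ y').
    by apply: joined_sub (jY _ _ Yy Yy') => z; exact: sY.
  by apply: joined_sym => //; exact: adj_sym.
- have Eb c : E c -> joined adj (fun c => c \notin s) b c.
    by move=> /asboolP/joined_reach; apply: joined_sub => z; rewrite sE negbK.
  move=> c d; rewrite !sE !negbK => /Eb bc /Eb bd.
  by apply: joined_trans bd; apply: joined_sym => //; exact: adj_sym.
- move=> c d; rewrite sE => nE dm cd; move/negP: nE; apply; apply/asboolP.
  apply: (@joined_trans _ _ _ d); first exact: joined_far dm.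
  by apply: joined_sym => //; exact: adj_sym.
Qed.

(** * Unions of hexagons *)

Section FillHexagon.
Variable R : realType.
Local Notation step := (@step R).

Ltac turn r :=
  match r with
  | 0%N => idtac
  | S ?r' => apply: step_rot; [by []|by []|by []|]; rewrite /rot /=; turn r'
  end.

(** The present neighbours are those numbered below [k]. Triangle [k - 1] is filled first, from its
    neighbour ([stepB]); then the triangles down to 0, each gaining its outer edge and one inner
    edge ([stepA] backwards); then those from [k] up to 4, each attached along one inner edge only
    ([stepA]). Triangle 5 closes up the hexagon by [stepB] backwards. *)
Lemma step_fill0 k : (0 < k < 6)%N ->
  step (nseq 6 false) (arc6 0 k) (nseq 6 true).
Proof.
move: k => [|[|[|[|[|[|//]]]]]] // _; rewrite /arc6 /rot /=.
- apply: (@step_trans _ [:: true; false; false; false; false; false]).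
    exact: (stepB R true).
  apply: (@step_trans _ [:: true; true; false; false; false; false]).
    turn 1%N; exact: (stepA R false).
  apply: (@step_trans _ [:: true; true; true; false; false; false]).
    turn 2%N; exact: (stepA R false).
  apply: (@step_trans _ [:: true; true; true; true; false; false]).
    turn 3%N; exact: (stepA R false).
  apply: (@step_trans _ [:: true; true; true; true; true; false]).
    turn 4%N; exact: (stepA R false).
  turn 5%N; apply: step_sym; exact: (stepB R false).
- apply: (@step_trans _ [:: false; true; false; false; false; false]).
    turn 1%N; exact: (stepB R true).
  apply: (@step_trans _ [:: true; true; false; false; false; false]).
    apply: step_sym; exact: (stepA R true).
  apply: (@step_trans _ [:: true; true; true; false; false; false]).
    turn 2%N; exact: (stepA R false).
  apply: (@step_trans _ [:: true; true; true; true; false; false]).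
    turn 3%N; exact: (stepA R false).
  apply: (@step_trans _ [:: true; true; true; true; true; false]).
    turn 4%N; exact: (stepA R false).
  turn 5%N; apply: step_sym; exact: (stepB R false).
- apply: (@step_trans _ [:: false; false; true; false; false; false]).
    turn 2%N; exact: (stepB R true).
  apply: (@step_trans _ [:: false; true; true; false; false; false]).
    turn 1%N; apply: step_sym; exact: (stepA R true).
  apply: (@step_trans _ [:: true; true; true; false; false; false]).
    apply: step_sym; exact: (stepA R true).
  apply: (@step_trans _ [:: true; true; true; true; false; false]).
    turn 3%N; exact: (stepA R false).
  apply: (@step_trans _ [:: true; true; true; true; true; false]).
    turn 4%N; exact: (stepA R false).
  turn 5%N; apply: step_sym; exact: (stepB R false).
- apply: (@step_trans _ [:: false; false; false; true; false; false]).
    turn 3%N; exact: (stepB R true).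
  apply: (@step_trans _ [:: false; false; true; true; false; false]).
    turn 2%N; apply: step_sym; exact: (stepA R true).
  apply: (@step_trans _ [:: false; true; true; true; false; false]).
    turn 1%N; apply: step_sym; exact: (stepA R true).
  apply: (@step_trans _ [:: true; true; true; true; false; false]).
    apply: step_sym; exact: (stepA R true).
  apply: (@step_trans _ [:: true; true; true; true; true; false]).
    turn 4%N; exact: (stepA R false).
  turn 5%N; apply: step_sym; exact: (stepB R false).
- apply: (@step_trans _ [:: false; false; false; false; true; false]).
    turn 4%N; exact: (stepB R true).
  apply: (@step_trans _ [:: false; false; false; true; true; false]).
    turn 3%N; apply: step_sym; exact: (stepA R true).
  apply: (@step_trans _ [:: false; false; true; true; true; false]).
    turn 2%N; apply: step_sym; exact: (stepA R true).
  apply: (@step_trans _ [:: false; true; true; true; true; false]).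
    turn 1%N; apply: step_sym; exact: (stepA R true).
  apply: (@step_trans _ [:: true; true; true; true; true; false]).
    apply: step_sym; exact: (stepA R true).
  turn 5%N; apply: step_sym; exact: (stepB R false).
Qed.

Lemma step_fill r k : (r < 6)%N -> (0 < k < 6)%N ->
  step (nseq 6 false) (arc6 r k) (nseq 6 true).
Proof.
move=> r6 k6; have {r6} : (r <= 6)%N := ltnW r6.
have [n] := ubnP (6 - r); elim: n r => // n IH r rn r6.
have [->|r6'] := eqVneq r 6%N.
  rewrite (_ : arc6 6 k = arc6 0 k); first exact: step_fill0.
  by rewrite /arc6 rot0 rot_oversize // size_cat !size_nseq; lia.
have r5 : (r < 6)%N by rewrite ltn_neqAle r6'.
apply: step_rot => //.
  by rewrite /arc6 size_rot size_cat !size_nseq; lia.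
rewrite (_ : rot 1 (arc6 r k) = arc6 r.+1 k); first by apply: IH => //; lia.
by rewrite /arc6 -(rotD (m := 1)) // size_cat !size_nseq; lia.
Qed.

End FillHexagon.

Section HexRegions.
Variable R : realType.
Implicit Types (p q : R * R) (c d : cell) (s : seq cell).

(* In these skew coordinates the cells are the unit balls of the hexagonal norm
   [max |x| |y| |x - y|], and [nbr c m] lies across the side of [c] in sector m. *)
Definition hex_center c : R * R := ((2 * c.1 - c.2)%:~R, (c.1 + c.2)%:~R).

Definition rel_to c p : R * R := (p.1 - (hex_center c).1, p.2 - (hex_center c).2).

Definition hexagon p : bool :=
  [&& -1 <= p.1 <= 1, -1 <= p.2 <= 1 & -1 <= p.1 - p.2 <= 1].

Definition region s : set (R * R) :=
  [set p | exists2 c, c \in s & hexagon (rel_to c p)].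

Lemma int_bound3 (a : int) : - 3%:R < a%:~R :> R -> a%:~R < 3%:R :> R -> - 3 < a < 3.
Proof.
move=> a1 a2; apply/andP; split; rewrite -(ltr_int R) //.
Qed.

(** The centres of [c] and [d] are at hexagonal distance less than 3, and only seven vectors of the
    lattice of centres are that short. *)
Lemma near2_hexagon c d p : near2 (rel_to c p) -> hexagon (rel_to d p) ->
  d = c \/ exists2 m, (m < 6)%N &
    [/\ d = nbr c m, sector m (rel_to c p) & 1 <= height m (rel_to c p)].
Proof.
pose a := d.1 - c.1; pose b := d.2 - c.2.
have Ed : d = (c.1 + a, c.2 + b).
  by rewrite /a /b [LHS]surjective_pairing; congr pair; lia.
have Er : rel_to d p = ((rel_to c p).1 - (2 * a - b)%:~R, (rel_to c p).2 - (a + b)%:~R).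
  by rewrite /rel_to /hex_center /a /b /=; congr pair;
    rewrite !(rmorphB, rmorphM, rmorphD) /=; lra.
rewrite {}Er {}Ed; case: (rel_to c p) => x y; rewrite /near2 /hexagon /=.
move=> /and3P[/andP[n1 n2] /andP[n3 n4] /andP[n5 n6]].
move=> /and3P[/andP[h1 h2] /andP[h3 h4] /andP[h5 h6]].
have A1 : -3 < 2 * a - b < 3 by apply: int_bound3; lra.
have A2 : -3 < a + b < 3 by apply: int_bound3; lra.
have A3 : -3 < (2 * a - b) - (a + b) < 3.
  by apply: int_bound3; rewrite rmorphB /=; lra.
move: (a) (b) A1 A2 A3 n1 n2 n3 n4 n5 n6 h1 h2 h3 h4 h5 h6 => {}a {}b A1 A2 A3.
have : [|| (a == -1) && (b == -1), (a == 0) && (b == -1), (a == -1) && (b == 0),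
    (a == 0) && (b == 0), (a == 1) && (b == 0), (a == 0) && (b == 1) |
    (a == 1) && (b == 1)].
  have : (a == -1) || (a == 0) || (a == 1) by lia.
  by case/orP => [/orP[]|] /eqP Ea; subst a; lia.
move=> ab n1 n2 n3 n4 n5 n6; move: ab.
do 6?[case/orP]; case/andP => /eqP-> /eqP->; move=> /= h1 h2 h3 h4 h5 h6.
- by right; exists 4%N => //=; split=> //; conj_lra.
- by right; exists 5%N => //=; split=> //; conj_lra.
- by right; exists 3%N => //=; split=> //; conj_lra.
- by left; rewrite !addr0 -surjective_pairing.
- by right; exists 0%N => //=; split=> //; conj_lra.
- by right; exists 2%N => //=; split=> //; conj_lra.
- by right; exists 1%N => //=; split=> //; conj_lra.
Qed.

Lemma hexagon_nbr c m p : (m < 6)%N -> near2 (rel_to c p) ->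
  sector m (rel_to c p) -> 1 <= height m (rel_to c p) -> hexagon (rel_to (nbr c m) p).
Proof.
have E : rel_to (nbr c m) p = ((rel_to c p).1 - (hex_center (dir m)).1,
                              (rel_to c p).2 - (hex_center (dir m)).2).
  by rewrite /rel_to /hex_center /nbr /=; congr pair;
    rewrite !(rmorphB, rmorphM, rmorphD) /=; lra.
rewrite E; case: (rel_to c p) => x y.
rewrite /near2 /hexagon /= => m6 /and3P[/andP[? ?] /andP[? ?] /andP[? ?]].
by move: m m6 {E} => [|[|[|[|[|[|//]]]]]] _ /= /andP[? ?] ?; conj_lra.
Qed.

End HexRegions.

(** * Simply connected unions of cells as homeomorphic images of one hexagon *)

Section HexDisk.
Variable R : realType.
Implicit Types (p q : R * R) (c d : cell) (s : seq cell).
Local Notation region := (@region R).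

Lemma homeo_translation (a : R * R) : homeo (fun p => (p.1 + a.1, p.2 + a.2)).
Proof.
split; first by continuity.
exists (fun p => (p.1 - a.1, p.2 - a.2)); split; first by continuity.
- by move=> [x y] /=; rewrite !addrK.
- by move=> [x y] /=; rewrite !subrK.
Qed.

Lemma sector_cover p : exists2 m, (m < 6)%N & sector m p.
Proof.
case: p => x y; have [?|?] := lerP 0 y; have [?|?] := lerP 0 x; have [?|?] := lerP x y;
  [exists 1%N|exists 0%N|exists 2%N|exists 2%N|exists 5%N|exists 5%N|exists 3%N|exists 4%N] => //=;
  conj_lra.
Qed.

Lemma height_hexagon m p : (m < 6)%N -> sector m p -> (height m p <= 1) = hexagon p.
Proof.
case: p => x y; rewrite /hexagon.
by move: m => [|[|[|[|[|[|//]]]]]] _ /= /andP[? ?];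
  apply/idP/idP => [?|/and3P[/andP[? ?] /andP[? ?] /andP[? ?]]]; conj_lra.
Qed.

Lemma hexagon_near2 p : hexagon p -> near2 p.
Proof.
case: p => x y; rewrite /hexagon /near2 /= => /and3P[/andP[? ?] /andP[? ?] /andP[? ?]].
by conj_lra.
Qed.

(** Inside [near2] around [c], the two regions are the configurations with the central hexagon empty
    and full over the same outer pattern; elsewhere they agree. So the local filling move,
    translated to [c], carries one to the other. *)
Lemma region_add_cell s c r k : c \notin s -> (r < 6)%N -> (0 < k < 6)%N ->
  [seq nbr c m \in s | m <- iota 0 6] = arc6 r k ->
  exists2 h, homeo h & forall p, region s p <-> region (c :: s) (h p).
Proof.
move=> cs r6 k6 Ee; pose e := arc6 r k.
have eE m : (m < 6)%N -> nth false e m = (nbr c m \in s).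
  by move=> m6; rewrite /e -Ee (nth_map 0%N) ?size_iota // nth_iota.
have [h0 [hh hout hin] hQ] := step_fill R r6 k6.
pose h p : R * R :=
  let q := h0 (rel_to c p) in (q.1 + (hex_center R c).1, q.2 + (hex_center R c).2).
have relh p : rel_to c (h p) = h0 (rel_to c p).
  by rewrite /h /rel_to /=; case: (h0 _) => x y /=; rewrite !addrK.
exists h.
  apply: (homeo_comp (homeo_translation (hex_center R c))).
  apply: (homeo_comp hh).
  exact: (homeo_translation (- (hex_center R c).1, - (hex_center R c).2)).
have emptyE p : near2 (rel_to c p) -> region s p <-> config (nseq 6 false) e (rel_to c p).
  move=> np; split.
    move=> [d ds hd]; have [E|[m m6 [E sm hm]]] := near2_hexagon np hd.
      by rewrite -E ds in cs.
    apply/configP; exists m => //; split=> //.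
    by rewrite eE // -E ds hm orbT.
  case/configP => m m6 [sm]; rewrite eE // nth_nseq if_same /= => /andP[ms hm].
  by exists (nbr c m) => //; exact: hexagon_nbr.
have fullE p : near2 (rel_to c p) -> region (c :: s) p <-> config (nseq 6 true) e (rel_to c p).
  move=> np; split.
    move=> [d]; rewrite inE => /predU1P[->|ds] hd.
      have [m m6 sm] := sector_cover (rel_to c p).
      apply/configP; exists m => //; split=> //.
      by rewrite nth_nseq m6 (height_hexagon m6 sm) hd.
    have [E|[m m6 [E sm hm]]] := near2_hexagon np hd; first by rewrite -E ds in cs.
    apply/configP; exists m => //; split=> //.
    by rewrite eE // -E ds hm orbT.
  case/configP => m m6 [sm]; rewrite eE // nth_nseq m6 /= => /orP[hm|/andP[ms hm]].
    by exists c; [exact: mem_head|rewrite -(height_hexagon m6 sm)].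
  by exists (nbr c m); [rewrite inE ms orbT|exact: hexagon_nbr].
move=> p; have [np|nnp] := boolP (near2 (rel_to c p)).
  rewrite (emptyE _ np) hQ -relh fullE //.
  by rewrite relh; exact: hin.
have -> : h p = p.
  by rewrite /h hout // /rel_to /= !subrK -surjective_pairing.
split=> [[d ds hd]|[d]]; first by exists d => //; rewrite inE ds orbT.
rewrite inE => /predU1P[->|ds] hd; last by exists d.
by rewrite hexagon_near2 in nnp.
Qed.

Lemma region_hexagon s y : y \in s ->
  joined_set adj (fun c => c \in s) -> joined_set adj (fun c => c \notin s) ->
  exists2 h, homeo h & forall p, hexagon p <-> region s (h p).
Proof.
have [n] := ubnP (size s); elim: n s y => // n IH s y sn ys js jc.
have [/allP all_y|] := boolP (all (pred1 y) s).
  exists (fun p => (p.1 + (hex_center R y).1, p.2 + (hex_center R y).2)).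
    exact: homeo_translation.
  move=> p; split=> [hp|[c /all_y/eqP->]].
    by exists y => //; rewrite /rel_to /= !addrK -surjective_pairing.
  by rewrite /rel_to /= !addrK -surjective_pairing.
rewrite -has_predC => /hasP[x xs /= xy].
have [c [cs jt jtc]] := removable_cell js jc ys xs xy.
set t := seq.filter (predC1 c) s in jt jtc.
have tE z : (z \in t) = (z != c) && (z \in s) by rewrite mem_filter.
have [w wt] : exists w, w \in t.
  have [E|] := eqVneq x c; last by move=> xc; exists x; rewrite tE xc.
  by exists y; rewrite tE ys -E eq_sym xy.
have tn : (size t < n)%N.
  apply: leq_trans (sn : (size s <= n)%N); rewrite size_filter -(count_predC (predC1 c) s).
  rewrite -[X in (X < _)%N]addn0 ltn_add2l -has_count; apply/hasP.
  by exists c => //=; rewrite eqxx.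
have [h1 hh1 h1E] := IH t w tn wt jt jtc.
have nbrt m : (nbr c m \in t) = (nbr c m \in s) by rewrite tE nbr_neq.
have exit_c (A : pred cell) z : joined_set adj A -> A c -> A z -> z != c ->
    exists2 m, (m < 6)%N & A (nbr c m).
  move=> jA Ac Az zc; have [|||u [v [cu uv Av vc]]] := @joined_exit _ adj A (pred1 c) c z.
  - exact: jA.
  - exact: eqxx.
  - exact: zc.
  have /joined_mem[_ /andP[_ /eqP uc]] := cu.
  by move: uv; rewrite uc => /adjP[m m6 E]; exists m; rewrite -?E.
have [r [k [r6 k6 Ee]]] : exists r k, [/\ (r < 6)%N, (0 < k < 6)%N &
    [seq nbr c m \in t | m <- iota 0 6] = arc6 r k].
  have nthE m : (m < 6)%N -> nth false [seq nbr c m \in t | m <- iota 0 6] m = (nbr c m \in t).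
    by move=> m6; rewrite (nth_map 0%N) ?size_iota // nth_iota.
  apply: arc6P; first by rewrite size_map size_iota.
  - have /andP[wc ws] : (w != c) && (w \in s) by rewrite -tE.
    have [m m6 ms] := exit_c (fun z => z \in s) w js cs ws wc.
    by exists m => //; rewrite nthE // nbrt.
  - have [c' [m [_ m6 ns nc]]] := exposed_cell c ys.
    have ct : c \notin t by rewrite tE eqxx.
    have nt : nbr c' m \notin t by rewrite tE (negbTE ns) andbF.
    have [m' m6' ms] := exit_c (fun z => z \notin t) (nbr c' m) jtc ct nt nc.
    by exists m' => //; rewrite nthE.
  (* Two neighbours in [t] separated around [c] by two neighbours outside [s] would give interleaved
     chains, one in [t] and one in the complement of [s], both avoiding [c]. *)
  - move=> a1 b1 a2 b2 a26 b26 ab sep.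
    have /andP[ab1 ab2] := ab.
    have b16 : (b1 < 6)%N by apply: ltn_trans a26.
    have a16 : (a1 < 6)%N by apply: ltn_trans b16.
    rewrite !nthE // => ta1 ta2; rewrite !nbrt -[_ || _]negbK negb_or.
    apply/negP => /andP[sb1 sb2].
    apply: (@joined_noncrossing (fun z => z \in t) (fun z => z \notin s) c a1 a2 b1 b2) => //.
    + by move=> z; rewrite tE negbK => /andP[].
    + by rewrite tE eqxx.
    + by rewrite negbK.
    + exact: jt.
    + exact: jc.
have ct : c \notin t by rewrite tE eqxx.
have [h2 hh2 h2E] := region_add_cell ct r6 k6 Ee.
exists (fun p => h2 (h1 p)); first exact: homeo_comp.
move=> p; rewrite h1E h2E; split=> -[d ds hd]; exists d => //.
  by move: ds; rewrite inE tE => /predU1P[->|/andP[]].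
by rewrite inE tE ds andbT; case: (d == c).
Qed.

End HexDisk.

(** * The hexagon is a disk *)

Section HexagonDisk.
Variable R : realType.
Implicit Types (p q : R * R).

(* On the chord of abscissa X, of half-length [sqrt (1 - X^2)], the map is linear
   onto the segment of the hexagon orthogonal to its diagonal, of half-length
   [min 1 (2 - 2 |X|)]. *)
Definition chord_scale (X : R) : R :=
  Num.sqrt ((1 - `|X|) / (1 + `|X|)) / Num.max (1 - `|X|) (1 / 2).

Definition disk_to_hexagon p : R * R :=
  (p.1 + p.2 * chord_scale p.1 / 2, p.1 - p.2 * chord_scale p.1 / 2).

Lemma cont_disk_to_hexagon : cont disk_to_hexagon.
Proof.
have cs : cont (fun p : R * R => chord_scale p.1).
  rewrite /chord_scale; refine (@cont_mul _ _ (fun p : R * R => _) (fun p => _) _ _).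
    refine (@cont_comp _ _ _ Num.sqrt (fun p : R * R => (1 - `|p.1|) / (1 + `|p.1|)) _ _).
      exact: sqrt_continuous.
    refine (@cont_mul _ _ (fun p : R * R => _) (fun p => _) _ _); first by continuity.
    refine (@cont_inv _ _ (fun p : R * R => _) _ _); last by continuity.
    by move=> p; apply: lt0r_neq0; have := normr_ge0 p.1; lra.
  refine (@cont_inv _ _ (fun p : R * R => _) _ _); last by continuity.
  by move=> p; apply: lt0r_neq0; rewrite lt_max; apply/orP; right; lra.
have c12 : cont (fun p : R * R => p.2 * chord_scale p.1).
  by refine (@cont_mul _ _ (fun p : R * R => p.2) (fun p => chord_scale p.1) _ cs); continuity.
rewrite /disk_to_hexagon.
refine (@cont_pair _ _ _ (fun p : R * R => _) (fun p => _) _ _).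
  refine (@cont_add _ _ (fun p : R * R => p.1) (fun p => _) _ _); first by continuity.
  by refine (@cont_mul _ _ _ (fun p => _) c12 _); continuity.
refine (@cont_add _ _ (fun p : R * R => p.1) (fun p => _) _ _); first by continuity.
apply: cont_opp; by refine (@cont_mul _ _ _ (fun p => _) c12 _); continuity.
Qed.

(** The factor [k] turns the half-chord [sqrt (1 - X^2)] into [1 - |X|], and division by [m] turns
    this into [min 1 (2 - 2 |X|)]. The equation for [k] is multiplied out so that it also serves at
    [|X| = 1], where [k = 0] and the chord is a point. *)
Lemma chord_scaleP X : `|X| <= 1 ->
  exists k m : R, [/\ chord_scale X = k / m,
    k ^+ 2 * (1 + `|X|) = 1 - `|X|, 1 - `|X| <= m, 1 / 2 <= m &
    m <= 1 - `|X| \/ m <= 1 / 2].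
Proof.
move=> X1; have X0 := normr_ge0 X.
exists (Num.sqrt ((1 - `|X|) / (1 + `|X|))), (Num.max (1 - `|X|) (1 / 2)).
split=> //.
- rewrite sqr_sqrtr; last by apply: divr_ge0; lra.
  by rewrite divfK //; apply: lt0r_neq0; lra.
- by rewrite le_max lexx.
- by rewrite le_max lexx orbT.
- by have [?|?] := lerP (1 - `|X|) (1 / 2); [right|left].
Qed.

Lemma closed_unit_disk_norm p : closed_unit_disk p -> `|p.1| <= 1.
Proof.
case: p => X Y; rewrite /closed_unit_disk /cnorm2 /= => D.
rewrite -(ler_pXn2r (n := 2)) ?nnegrE // expr1n real_normK ?num_real //.
by have := sqr_ge0 Y; lra.
Qed.

Lemma disk_to_hexagon_inj p q : closed_unit_disk p -> closed_unit_disk q ->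
  disk_to_hexagon p = disk_to_hexagon q -> p = q.
Proof.
move=> Dp Dq; have Xp := closed_unit_disk_norm Dp.
have [k [m [sE kE m1 m2 _]]] := chord_scaleP Xp.
case: p q Dp Dq Xp sE kE m1 => X Y [X' Y'] /= Dp Dq Xp sE kE m1.
rewrite /disk_to_hexagon /= => -[E1 E2].
have EX : X' = X by lra.
rewrite {}EX in E1 E2 Dq *; move: E1 E2; rewrite sE => E1 _; congr pair.
have m0 : m != 0 by apply: lt0r_neq0; lra.
have [k0|k0] := eqVneq k 0; last first.
  have E3 : (Y - Y') * (k / m) = 0 by lra.
  move/eqP: E3; rewrite mulf_eq0 mulf_eq0 invr_eq0 (negbTE k0) (negbTE m0) !orbF.
  by rewrite subr_eq0 => /eqP.
have X1 : X ^+ 2 = 1.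
  by rewrite -(real_normK (num_real X)) (_ : `|X| = 1) ?expr1n //; move: kE; rewrite k0; lra.
have on_axis (y : R) : closed_unit_disk (X, y) -> y = 0.
  rewrite /closed_unit_disk /cnorm2 /= X1 => y1; apply/eqP; rewrite -sqrf_eq0.
  by rewrite eq_le sqr_ge0 andbT; lra.
by rewrite (on_axis _ Dp) (on_axis _ Dq).
Qed.

Lemma hexagonE (x y : R) : hexagon (x, y) = (`|x - y| <= 1) && (`|x + y| + `|x - y| <= 2).
Proof.
rewrite /hexagon /=; apply/idP/idP.
  move=> /and3P[/andP[? ?] /andP[? ?] /andP[? ?]].
  by case: (ger0P (x - y)) => ?; case: (ger0P (x + y)) => ?; apply/andP; split; lra.
by case: (ger0P (x - y)) => ?; case: (ger0P (x + y)) => ? /andP[? ?]; conj_lra.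
Qed.

Lemma disk_to_hexagon_img : disk_to_hexagon @` @closed_unit_disk R = [set p | hexagon p].
Proof.
apply/seteqP; split=> [_ [[X Y] Dp <-]|[x y]].
  have /= Xp := closed_unit_disk_norm Dp.
  have [k [m [sE kE m1 m2 m3]]] := chord_scaleP Xp.
  have m0 : 0 < m by lra.
  have X0 := normr_ge0 X.
  rewrite /mkset /disk_to_hexagon /= sE hexagonE.
  have -> : X + Y * (k / m) / 2 + (X - Y * (k / m) / 2) = 2 * X by lra.
  have -> : X + Y * (k / m) / 2 - (X - Y * (k / m) / 2) = (Y * k) / m by lra.
  have Yk : `|Y * k| <= 1 - `|X|.
    rewrite -(ler_pXn2r (n := 2)) ?nnegrE //; last by lra.
    rewrite real_normK ?num_real // exprMn.
    move: Dp; rewrite /closed_unit_disk /cnorm2 /= -(real_normK (num_real X)) => Dp.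
    have k2 : 0 <= k ^+ 2 := sqr_ge0 k.
    have := ler_wpM2r k2 (_ : Y ^+ 2 <= 1 - `|X| ^+ 2).
    move=> /(_ ltac:(lra)) YK; apply: (le_trans YK).
    by rewrite (_ : (1 - `|X| ^+ 2) * k ^+ 2 = (1 - `|X|) * (k ^+ 2 * (1 + `|X|))); [rewrite kE expr2|ring].
  have -> : `|Y * k / m| = `|Y * k| / m by rewrite normrM normfV (gtr0_norm m0).
  have -> : `|2 * X| = 2 * `|X| by rewrite normrM ger0_norm.
  have dm : `|Y * k| / m <= 1 by rewrite ler_pdivrMr // mul1r; lra.
  rewrite dm /=.
  have : `|Y * k| / m <= 2 * (1 - `|X|) by rewrite ler_pdivrMr //; nra.
  by lra.
rewrite /= hexagonE => /andP[d1 d2].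
pose X := (x + y) / 2.
have X1 : `|X| <= 1.
  rewrite /X normrM normfV (ger0_norm (_ : 0 <= 2 :> R)) //.
  by have := normr_ge0 (x - y); lra.
have [k [m [sE kE m1 m2 m3]]] := chord_scaleP X1.
have m0 : 0 < m by lra.
have XE : `|x + y| = 2 * `|X| by rewrite /X normrM normfV (ger0_norm (_ : 0 <= 2 :> R)) //; lra.
have X0 := normr_ge0 X.
have [k0|k0] := eqVneq k 0.
  exists (X, 0); last first.
    rewrite /disk_to_hexagon /= !mul0r addr0 subr0 /X.
    have d0 : x - y = 0.
      by apply/eqP; rewrite -normr_le0; move: kE; rewrite k0; lra.
    by congr pair; lra.
  rewrite /closed_unit_disk /cnorm2 /= -(real_normK (num_real X)).
  by move: kE; rewrite k0; nra.
exists (X, (x - y) * m / k); last first.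
  rewrite /disk_to_hexagon /= sE (_ : (x - y) * m / k * (k / m) = x - y).
    by congr pair; rewrite /X; lra.
  by field; rewrite k0 lt0r_neq0.
rewrite /closed_unit_disk /cnorm2 /= -(real_normK (num_real X)).
have dm : `|x - y| * m <= 1 - `|X|.
  by have := normr_ge0 (x - y); case: m3 => ?; nra.
rewrite exprMn exprVn; have k2 : 0 < k ^+ 2 by rewrite exprn_even_gt0.
have : ((x - y) * m) ^+ 2 / k ^+ 2 <= (1 - `|X|) * (1 + `|X|).
  rewrite ler_pdivrMr // (_ : _ * k ^+ 2 = (1 - `|X|) * (k ^+ 2 * (1 + `|X|))); last by ring.
  rewrite kE -expr2 -(real_normK (num_real ((x - y) * m))) ler_pXn2r ?nnegrE //; last by lra.
  by rewrite normrM (ger0_norm (ltW m0)).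
lra.
Qed.

Lemma hexagon_disk h : homeo h -> closed_top_disk (h @` [set p : R * R | hexagon p]).
Proof.
move=> [ch [h' [ch' hK h'K]]]; exists (fun p => h (disk_to_hexagon p)); split.
  by apply: continuous_subspaceT; exact: (cont_comp ch cont_disk_to_hexagon).
split; first by move=> p q Dp Dq /(can_inj hK); exact: disk_to_hexagon_inj.
by rewrite -disk_to_hexagon_img image_comp.
Qed.

End HexagonDisk.

(** * Cells meeting a connected set *)

Section CellCover.
Variable R : realType.
Implicit Types (p q : R * R) (c d : cell).

Definition hexnorm p : R := Num.max `|p.1| (Num.max `|p.2| `|p.1 - p.2|).

Lemma cont_hexnorm_rel c : cont (fun p => hexnorm (rel_to c p)).
Proof. by rewrite /hexnorm /rel_to /=; continuity. Qed.

Lemma hexagon_hexnorm p : hexagon p = (hexnorm p <= 1).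
Proof. by rewrite /hexagon /hexnorm !ge_max !ler_norml. Qed.

Lemma near2_hexnorm p : near2 p = (hexnorm p < 2).
Proof. by rewrite /near2 /hexnorm !gt_max !ltr_norml. Qed.

Lemma cont_nbhs_lt (f : R * R -> R) p a : cont f -> f p < a -> \forall q \near p, f q < a.
Proof. move=> cf fp; apply: (cf p [set x | x < a]).
by apply: open_nbhs_nbhs; split=> //; exact: open_lt. Qed.

Lemma cont_nbhs_gt (f : R * R -> R) p a : cont f -> a < f p -> \forall q \near p, a < f q.
Proof. move=> cf fp; apply: (cf p [set x | a < x]).
by apply: open_nbhs_nbhs; split=> //; exact: open_gt. Qed.

(** The centres are the integer points whose coordinate sum is divisible by 3. One of them is a
    suitable corner of the unit square around [p]: the residue of [a + b] selects the lower left
    corner, the upper right one, or one of the two others according to the side of the diagonal. *)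
Lemma hex_cover p : exists c, hexagon (rel_to c p).
Proof.
case: p => x y.
have floorP (t : R) : exists a : int, a%:~R <= t /\ t < a%:~R + 1.
  by exists (Num.floor t); have /andP[? ?] := floor_itv t; rewrite -(rmorphD _ _ 1) /=.
have [a [a1 a2]] := floorP x; have [b [b1 b2]] := floorP y.
have hex (u v : int) i : u + v = 3 * i -> -1 <= x - u%:~R <= 1 -> -1 <= y - v%:~R <= 1 ->
    -1 <= (x - u%:~R) - (y - v%:~R) <= 1 -> exists c, hexagon (rel_to c (x, y)).
  move=> E h1 h2 h3; exists (i, v - i); rewrite /hexagon /rel_to /hex_center /=.
  have -> : 2 * i - (v - i) = u by clear - E; lia.
  by have -> : i + (v - i) = v; [clear; lia|apply/and3P].
have [k Ek] : exists k, [\/ a + b = 3 * k, a + b + 2 = 3 * k | a + b + 1 = 3 * k].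
  have := divz_eq (a + b) 3; have := modz_ge0 (a + b) (isT : (3 : int) != 0).
  have := ltz_pmod (a + b) (isT : 0 < (3 : int)).
  move: ((a + b) %/ 3)%Z ((a + b) %% 3)%Z => u v v3 v0 E.
  have : (v == 0) || (v == 1) || (v == 2) by clear - v3 v0; lia.
  case/orP => [/orP[]|] /eqP Ev; [exists u; apply: Or31|exists (u + 1); apply: Or32|
    exists (u + 1); apply: Or33]; rewrite E Ev; clear; lia.
case: Ek => E.
- by apply: (hex a b k) => //; conj_lra.
- by apply: (hex (a + 1) (b + 1) k); rewrite ?rmorphD /=; [clear - E; lia|conj_lra..].
- have [?|?] := lerP (x - a%:~R) (y - b%:~R).
    by apply: (hex a (b + 1) k); rewrite ?rmorphD /=; [clear - E; lia|conj_lra..].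
  by apply: (hex (a + 1) b k); rewrite ?rmorphD /=; [clear - E; lia|conj_lra..].
Qed.

(** The tiling is locally finite: near [p] only a cell containing [p] and its six neighbours matter,
    so finitely many neighbourhoods are intersected. *)
Lemma closed_cells (P : cell -> Prop) :
  closed [set p : R * R | exists2 c, P c & hexagon (rel_to c p)].
Proof.
rewrite closedE => p; apply: contra_notP => np.
have [c0 pc0] := hex_cover p.
have away c : P c -> \forall q \near p, 1 < hexnorm (rel_to c q).
  move=> Pc; apply: cont_nbhs_gt; first exact: cont_hexnorm_rel.
  by rewrite ltNge -hexagon_hexnorm; apply/negP => hc; apply: np; exists c.
have away' c : \forall q \near p, P c -> 1 < hexnorm (rel_to c q).
  have [/away Pc|nP] := pselect (P c); first by apply: filterS Pc.
  by apply: filterE => q /nP.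
have near0 : \forall q \near p, near2 (rel_to c0 q).
  have : \forall q \near p, hexnorm (rel_to c0 q) < 2.
    apply: cont_nbhs_lt; first exact: cont_hexnorm_rel.
    by rewrite -near2_hexnorm hexagon_near2.
  by apply: filterS => q; rewrite -near2_hexnorm.
have awayn : \forall q \near p, forall m : 'I_6, P (nbr c0 m) -> 1 < hexnorm (rel_to (nbr c0 m) q).
  exact: (@filter_forall _ 'I_6 (fun (m : 'I_6) q =>
    P (nbr c0 m) -> 1 < hexnorm (rel_to (nbr c0 m) q)) (nbhs p) _ (fun m => away' _)).
have a0 := away' c0.
near=> q.
have q0 : P c0 -> 1 < hexnorm (rel_to c0 q) by near: q.
have q1 : forall m : 'I_6, P (nbr c0 m) -> 1 < hexnorm (rel_to (nbr c0 m) q) by near: q.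
have q2 : near2 (rel_to c0 q) by near: q.
move=> [c Pc hc].
have : 1 < hexnorm (rel_to c q).
  have [E|[m m6 [E _ _]]] := near2_hexagon q2 hc; first by rewrite E; apply: q0; rewrite -E.
  by rewrite E; apply: (q1 (Ordinal m6)); rewrite /= -E.
by rewrite ltNge -hexagon_hexnorm hc.
Unshelve. all: by end_near. Qed.

Lemma hexagon_adj c d p : hexagon (rel_to c p) -> hexagon (rel_to d p) ->
  d = c \/ adj c d.
Proof.
move=> hc hd; have [->|[m m6 [-> _ _]]] := near2_hexagon (hexagon_near2 hc) hd; first by left.
by right; exact: adj_nbr.
Qed.

(** The cells reached by chains from [c] and the remaining cells cover [C] by two closed sets. These
    are disjoint on [C], since two cells with a common point are equal or adjacent. *)
Lemma connected_cells (C : set (R * R)) : connected C ->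
  joined_set adj (fun c => `[< exists2 p, C p & hexagon (rel_to c p) >]).
Proof.
move=> cC; set Z : pred cell := (fun c => _) => c d Zc Zd.
pose A c' := joined adj Z c c'.
pose B := C `&` [set p | exists2 c', A c' & hexagon (rel_to c' p)].
have ZP c' p : C p -> hexagon (rel_to c' p) -> Z c'.
  by move=> Cp hp; apply/asboolP; exists p.
have AA c1 c2 p : C p -> hexagon (rel_to c1 p) -> hexagon (rel_to c2 p) -> A c1 -> A c2.
  move=> Cp h1 h2 A1; have [->//|a12] := hexagon_adj h1 h2.
  by apply: joined_trans A1 _; apply: joined1 => //; apply: ZP Cp _.
have BE : B = C.
  apply: cC.
  - have /asboolP[p Cp hp] := Zc.
    by exists p; split=> //; exists c => //; exact: joined_refl.
  - exists (~` [set p | exists2 c', ~ A c' & hexagon (rel_to c' p)]).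
      by apply: closed_openC; exact: closed_cells.
    apply/seteqP; split=> p [Cp].
      move=> [c1 A1 h1]; split=> // -[c2 A2 h2]; apply: A2.
      exact: AA Cp h1 h2 A1.
    move=> nA; split=> //; have [c1 h1] := hex_cover p; exists c1 => //.
    by apply: contrapT => nA1; apply: nA; exists c1.
  - by exists [set p | exists2 c', A c' & hexagon (rel_to c' p)] => //; exact: closed_cells.
have /asboolP[p Cp hp] := Zd.
have : B p by rewrite BE.
by move=> [_ [c1 A1 h1]]; exact: AA Cp h1 hp A1.
Qed.

End CellCover.

(** * Topological disks between a connected set and its neighbourhood *)

Section DiskBetween.
Variable R : realType.
Implicit Types (p q x : R * R) (C D K U V : set (R * R)) (c d : cell).

Definition bounded2 C : Prop := exists M, forall p, C p -> `|p.1| <= M /\ `|p.2| <= M.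

(** The complement of the filling of [V]. Asking for a connected set rather than a path lets
    closures, images and overlapping unions serve as witnesses. *)
Definition escapes V x : Prop :=
  exists C, [/\ connected C, C x, forall p, C p -> ~ V p & ~ bounded2 C].

Definition scale (l : R) p : R * R := (l * p.1, l * p.2).

Lemma cont_scale l : cont (scale l).
Proof. by rewrite /scale; continuity. Qed.

Lemma scaleK l : l != 0 -> cancel (scale l) (scale l^-1).
Proof. by move=> l0 [x y]; rewrite /scale /= !mulKf. Qed.

Lemma homeo_scale l : l != 0 -> homeo (scale l).
Proof.
move=> l0; split; first exact: cont_scale.
exists (scale l^-1); split; [exact: cont_scale|exact: scaleK|].
by move=> p; rewrite -{1}(invrK l) scaleK // invr_eq0.
Qed.

Lemma cont_ray x : cont (fun t => scale t x).
Proof.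
have cid : cont (fun t : R => t) by move=> t; exact: cvg_id.
by rewrite /scale; refine (@cont_pair _ _ _ (fun t => _) (fun t => _) _ _);
  refine (@cont_mul _ _ _ (fun t => _) cid _); continuity.
Qed.

Lemma connected_image (T T' : topologicalType) (f : T -> T') (A : set T) :
  cont f -> connected A -> connected (f @` A).
Proof.
by move=> cf cA; apply: connected_continuous_connected => //; exact: continuous_subspaceT.
Qed.

Lemma compact_square (M : R) : compact [set p : R * R | `|p.1| <= M /\ `|p.2| <= M].
Proof.
rewrite (_ : [set p | _] = `[- M, M]%classic `*` `[- M, M]%classic).
  by apply: compact_setX; exact: segment_compact.
by apply/seteqP; split=> -[x y] /=; rewrite !in_itv /= !ler_norml.
Qed.

Lemma compact_bounded2 C : compact C -> bounded2 C.
Proof.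
move=> cC; have bnd (f : R * R -> R) : cont f -> exists M, forall p, C p -> f p <= M.
  move=> cf; have [C0|C0] := pselect (C !=set0); last first.
    by exists 0 => p Cp; exfalso; apply: C0; exists p.
  have [c _ cM] := compact_EVT_max C0 cC (continuous_subspaceT cf).
  by exists (f c) => p Cp; apply: cM; rewrite inE.
have [|M1 H1] := bnd (fun p => `|p.1|); first by continuity.
have [|M2 H2] := bnd (fun p => `|p.2|); first by continuity.
exists (Num.max M1 M2) => p Cp.
by split; rewrite le_max ?H1 ?H2 ?orbT.
Qed.

Lemma homeo_bounded2 h C : homeo h -> bounded2 (h @` C) -> bounded2 C.
Proof.
move=> [ch [h' [ch' hK h'K]]] [M HM].
have [N HN] : bounded2 (h' @` [set p | `|p.1| <= M /\ `|p.2| <= M]).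
  apply/compact_bounded2/continuous_compact; last exact: compact_square.
  exact: continuous_subspaceT.
exists N => p Cp; rewrite -(hK p); apply: HN; exists (h p) => //=.
by apply: HM; exists p.
Qed.

Lemma escapes_homeo h V x : homeo h -> escapes V x -> escapes (h @` V) (h x).
Proof.
move=> hh [C [cC Cx CV bC]]; have [ch [h' [ch' hK h'K]]] := hh.
exists (h @` C); split.
- exact: connected_image.
- by exists x.
- by move=> _ [p Cp <-] [v Vv] /(can_inj hK) vp; apply: (CV p) => //; rewrite -vp.
- by apply: contra_not bC; exact: homeo_bounded2.
Qed.

Lemma escapes_sub V W x : V `<=` W -> escapes W x -> escapes V x.
Proof.
by move=> VW [C [cC Cx CW bC]]; exists C; split=> // p /CW nW /VW.
Qed.

Lemma escapes_homeo_inv h V x : homeo h -> escapes (h @` V) (h x) -> escapes V x.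
Proof.
move=> hh; have [ch [h' [ch' hK h'K]]] := hh.
have hh' : homeo h' by split=> //; exists h.
move=> /(escapes_homeo hh'); rewrite hK; apply: escapes_sub => v Vv.
by exists (h v); [exists v|rewrite hK].
Qed.

Lemma nbhs_homeo h C x : homeo h -> nbhs (h x) (h @` C) <-> nbhs x C.
Proof.
move=> [ch [h' [ch' hK h'K]]]; split=> H.
  have H' : nbhs x (h @^-1` (h @` C)) := ch x _ H.
  by apply: filterS H' => q /= [p Cp /(can_inj hK) <-].
have {}H : nbhs (h' (h x)) C by rewrite hK.
have H' : nbhs (h x) (h' @^-1` C) := ch' _ _ H.
by apply: filterS H' => q /= Cq; exists (h' q).
Qed.

Lemma rel_to0 p : rel_to (0, 0) p = p.
Proof. by case: p => x y; congr pair => /=; rewrite ?(mulr0, addr0, subr0). Qed.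

Lemma nbhs_hexagon0 : nbhs ((0, 0) : R * R) [set p : R * R | hexagon p].
Proof.
have : \forall q \near ((0, 0) : R * R), hexnorm (rel_to (0, 0) q) < 1.
  apply: cont_nbhs_lt; first exact: cont_hexnorm_rel.
  by rewrite rel_to0 /hexnorm /= subr0 normr0 !maxxx ltr01.
by apply: filterS => q; rewrite rel_to0 => /ltW; rewrite -hexagon_hexnorm.
Qed.

Lemma ray_escapes V x : x <> (0, 0) -> (forall t, 1 <= t -> ~ V (scale t x)) ->
  escapes V x.
Proof.
move=> x0 nV; exists ((fun t : R => scale t x) @` [set t | 1 <= t]); split.
- apply: connected_image; first exact: cont_ray.
  by apply/connected_intervalP => a b /= a1 b1 t /andP[at1 _]; exact: le_trans at1.
- by exists 1 => //=; rewrite /scale !mul1r -surjective_pairing.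
- by move=> _ [t /= t1 <-]; exact: nV.
- move=> [M HM]; apply: x0.
  have {}HM t : 1 <= t -> `|t * x.1| <= M /\ `|t * x.2| <= M.
    by move=> t1; apply: (HM (scale t x)); exists t.
  have M0 : 0 <= M by have [/(le_trans (normr_ge0 _))] := HM 1 (lexx 1).
  have zero (w : R) : (forall t, 1 <= t -> t * `|w| <= M) -> w = 0.
    move=> H; apply/eqP; apply: contraT => w0.
    have w1 : 0 < `|w| by rewrite normr_gt0.
    have [a a0 aw] : exists2 a, 0 <= a & a * `|w| = M + 1.
      by exists ((M + 1) / `|w|); rewrite ?divfK ?lt0r_neq0 // divr_ge0 ?addr_ge0.
    have a1 : 1 <= a + 1 by lra.
    by have := H _ a1; rewrite mulrDl aw; lra.
  rewrite [x]surjective_pairing; congr pair; apply: zero => t t1; have [m1 m2] := HM t t1.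
    by rewrite -[t](ger0_norm (_ : 0 <= t)) -?normrM //; lra.
  by rewrite -[t](ger0_norm (_ : 0 <= t)) -?normrM //; lra.
Qed.

(** The hexagon is star-shaped about 0, so the outward ray from a point that is not interior never
    enters the interior. *)
Lemma escapes_hexagon x : ~ nbhs x [set p : R * R | hexagon p] ->
  escapes (interior [set p : R * R | hexagon p]) x.
Proof.
move=> nx; apply: ray_escapes => [x0|t t1 nt]; apply: nx.
  by rewrite x0; exact: nbhs_hexagon0.
have nt' : nbhs x (scale t @^-1` [set p | hexagon p]) := cont_scale nt.
apply: filterS nt' => -[u v]; rewrite /preimage /scale /hexagon /=.
move=> /and3P[/andP[? ?] /andP[? ?] /andP[? ?]].
by apply/and3P; split; apply/andP; split; nra.
Qed.

Lemma in_box_bound (m : nat) c : in_box m c = (`|c.1%:~R| < m%:R :> R) && (`|c.2%:~R| < m%:R :> R).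
Proof.
by rewrite /in_box -!(ltr_nat R) !natr_absz !intr_norm.
Qed.

Lemma cell_bound c p (B : R) : hexagon (rel_to c p) -> `|p.1| <= B -> `|p.2| <= B ->
  `|c.1%:~R| <= B + 1 /\ `|c.2%:~R| <= B + 1.
Proof.
case: c p => i j [x y]; rewrite /hexagon /rel_to /hex_center /= !(rmorphB, rmorphM, rmorphD) /=.
move=> /and3P[/andP[? ?] /andP[? ?] /andP[? ?]]; rewrite !ler_norml => /andP[? ?] /andP[? ?].
by split; apply/andP; split; lra.
Qed.

Lemma cell_bound_point c p (B : R) : hexagon (rel_to c p) ->
  `|c.1%:~R| <= B -> `|c.2%:~R| <= B -> `|p.1| <= 3 * B + 1 /\ `|p.2| <= 3 * B + 1.
Proof.
case: c p => i j [x y]; rewrite /hexagon /rel_to /hex_center /= !(rmorphB, rmorphM, rmorphD) /=.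
move=> /and3P[/andP[? ?] /andP[? ?] /andP[? ?]]; rewrite !ler_norml => /andP[? ?] /andP[? ?].
by split; apply/andP; split; lra.
Qed.

Theorem disk_between K U (eps : R) : 0 < eps -> K !=set0 -> open K -> connected K ->
  bounded2 K ->
  (forall p q, K p -> `|q.1 - p.1| <= eps -> `|q.2 - p.2| <= eps -> U q) ->
  exists D, [/\ closed_top_disk D, K `<=` interior D, forall x, D x -> ~ escapes U x &
    forall x, ~ interior D x -> escapes (interior D) x].
Proof.
move=> eps0 [k0 Kk0] oK cK [M HM] KU.
(* A cell has width 2 in both coordinates; scaled by [l], it has width [eps], so a cell that meets
   [K] lies in [U]. *)
have [l l0 lE] : exists2 l, 0 < l & 2 * l = eps.
  by exists (eps / 2); [rewrite divr_gt0|lra].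
have ln0 : l != 0 by rewrite lt0r_neq0.
have hsc := homeo_scale ln0; have [csc [sc' [csc' scK sc'K]]] := hsc.
pose meets C : pred cell := fun c => `[< exists2 p, (scale l @^-1` C) p & hexagon (rel_to c p) >].
have joined_meets C : connected C -> joined_set adj (meets C).
  move=> cC; apply: connected_cells.
  rewrite (_ : _ @^-1` _ = sc' @` C); first exact: connected_image.
  apply/seteqP; split=> [p Cp|_ [p Cp <-]]; first by exists (scale l p).
  by rewrite /preimage /= sc'K.
have meetsI C p : C p -> exists2 c, meets C c & hexagon (rel_to c (sc' p)).
  move=> Cp; have [c hc] := hex_cover (sc' p); exists c => //.
  by apply/asboolP; exists (sc' p) => //; rewrite /preimage /= sc'K.
pose Y := meets K.
have [m Ym] : exists m, forall c, Y c -> in_box m c.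
  exists (Num.trunc (M / l + 1)).+1 => c /asboolP[p Kp hp].
  have [] := HM _ Kp; rewrite /scale /= !normrM (gtr0_norm l0) => M1 M2.
  have [||b1 b2] := cell_bound hp (B := M / l); try by rewrite ler_pdivlMr // mulrC.
  by rewrite in_box_bound !(le_lt_trans _ (truncnS_gt (M / l + 1))).
have [c0 Y0 _] := meetsI K k0 Kk0.
have [s [Ys js jsc far]] := fill_cells Y0 Ym (joined_meets _ cK).
have [h hh hE] := region_hexagon R (Ys _ Y0) js jsc.
pose H p := scale l (h p); have hH : homeo H by exact: homeo_comp.
pose D := H @` [set p | hexagon p].
have DE p : D p <-> region s (sc' p).
  split=> [[q hq <-]|sp]; first by rewrite /H scK -hE.
  have [ch [h' [ch' hK h'K]]] := hh.
  by exists (h' (sc' p)); rewrite /H /= ?hE h'K.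
exists D; split.
- exact: hexagon_disk.
- move=> p Kp; have : nbhs p K by apply: open_nbhs_nbhs.
  apply: filterS => q /meetsI[c Yc hc]; apply/DE; exists c => //; exact: Ys.
(* The cells met by a connected set avoiding [U] are not in [Y] and are joined to each other. If
   that set is unbounded, they form a chain from [c] to outside the box, which the filling [s]
   excludes. *)
- move=> x /DE[c cs hc] [C [cC Cx CU bC]].
  have subY d : meets C d -> predC Y d.
    move=> /asboolP[p Cp hp]; apply/negP => /asboolP[q Kq hq].
    apply: (CU _ Cp); move: Kq hp hq; rewrite /preimage.
    case: p q {Cp} => x1 y1 [x2 y2] /= Kq; rewrite /hexagon /rel_to /=.
    move=> /and3P[/andP[? ?] /andP[? ?] _] /and3P[/andP[? ?] /andP[? ?] _].
    by apply: (KU _ _ Kq); rewrite /scale /= -mulrBr normrM (gtr0_norm l0) -lE mulrC ler_pM2r //;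
      rewrite ler_norml; apply/andP; split; lra.
  have mc : meets C c by apply/asboolP; exists (sc' x) => //; rewrite /preimage /= sc'K.
  have [d md nd] : exists2 d, meets C d & ~~ in_box m d.
    apply: contrapT => nd; apply: bC.
    exists (l * (3 * m%:R + 1)) => p Cp; have [d md hd] := meetsI C p Cp.
    have : in_box m d by apply: contraT => dm; exfalso; apply: nd; exists d.
    rewrite in_box_bound => /andP[/ltW d1 /ltW d2].
    have [p1 p2] := cell_bound_point hd d1 d2.
    rewrite -(sc'K p) /scale /= !normrM (gtr0_norm l0).
    by split; rewrite ler_pM2l.
  by apply: (far c d cs nd); apply: joined_sub subY _; apply: joined_meets.
- move=> x nx; have [_ [H' [_ HK H'K]]] := hH.
  have intD y : interior D (H y) <-> interior [set p | hexagon p] y.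
    exact: nbhs_homeo.
  rewrite -(H'K x); have : escapes (interior [set p | hexagon p]) (H' x).
    by apply: escapes_hexagon => nH; apply: nx; rewrite -(H'K x); apply/intD.
  move=> /(escapes_homeo hH); apply: escapes_sub => y Dy.
  by exists (H' y) => //; apply/intD; rewrite H'K.
Qed.

End DiskBetween.

(** * Fillings of disjoint translates *)

Section NestedFills.
Variable R : realType.
Implicit Types (p q x y c : R * R) (A B C V : set (R * R)).

Definition translate c p : R * R := (p.1 + c.1, p.2 + c.2).

Lemma homeo_translate c : homeo (translate c).
Proof. exact: homeo_translation. Qed.

Lemma escapes_far V (M : R) y : (forall p, V p -> `|p.1| <= M /\ `|p.2| <= M) ->
  0 <= M -> M < `|y.1| \/ M < `|y.2| -> escapes V y.
Proof.
move=> VM M0 yM; apply: ray_escapes => [y0|t t1 /VM[]].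
  by move: yM; rewrite y0 /= normr0; case; lra.
rewrite /scale /= !normrM (ger0_norm (_ : 0 <= t)); last by lra.
by have := normr_ge0 y.1; have := normr_ge0 y.2; case: yM => ? ? ? ?; nra.
Qed.

Lemma escapes_connected A V w x : connected A -> (forall p, A p -> ~ V p) ->
  A w -> A x -> escapes V w -> escapes V x.
Proof.
move=> cA AV Aw Ax [C [cC Cw CV bC]]; exists (A `|` C); split.
- by apply: connectedU => //; exists w.
- by left.
- by move=> p [/AV|/CV].
- by apply: contra_not bC => -[M HM]; exists M => p Cp; apply: HM; right.
Qed.

(* If B lies in the filling of A, then so does the filling of B, and the
   translation from A to B maps the filling of A to itself. *)
Lemma translate_escapes A c : A !=set0 -> bounded2 A -> c <> (0, 0) ->
  exists2 y, (translate c @` A) y & escapes A y.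
Proof.
move=> [a Aa] [M HM] c0; apply: contrapT => nP.
have M0 : 0 <= M by have [/(le_trans (normr_ge0 _))] := HM a Aa.
(* A set witnessing that the translated point escapes [A] also avoids the translate of [A], because
   each of its points escapes [A]. Iterating then gives an unbounded orbit in the bounded filling of
   [A]. *)
have shift y : ~ escapes A y -> ~ escapes A (translate c y).
  move=> ny [C [cC Cy CA bC]]; apply: ny.
  apply: (escapes_homeo_inv (homeo_translate c)); exists C; split=> // p Cp Bp.
  by apply: nP; exists p => //; exists C.
have orbit n : ~ escapes A (a.1 + n%:R * c.1, a.2 + n%:R * c.2).
  elim: n => [|n IH].
    by rewrite !mul0r !addr0 -surjective_pairing => -[C [_ Ca /(_ _ Ca)]].
  rewrite (_ : (_, _) = translate c (a.1 + n%:R * c.1, a.2 + n%:R * c.2)); first exact: shift.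
  by congr pair => /=; rewrite -natr1; ring.
have bnd n : `|a.1 + n%:R * c.1| <= M /\ `|a.2 + n%:R * c.2| <= M.
  split; rewrite leNgt; apply/negP => lt; apply: (orbit n);
    apply: (@escapes_far _ M) => //; first [by left|by right].
have zero (u v : R) : (forall n : nat, `|u + n%:R * v| <= M) -> v = 0.
  move=> H; apply/eqP; apply: contraT => v0; exfalso.
  have v1 : 0 < `|v| by rewrite normr_gt0.
  have H0 := H 0%N; rewrite mul0r addr0 in H0.
  have [n n1] : exists n : nat, 2 * M + 1 < n%:R * `|v|.
    by exists (Num.trunc ((2 * M + 1) / `|v|)).+1; rewrite -ltr_pdivrMr // truncnS_gt.
  have n2 := H n.
  have : `|n%:R * v| <= 2 * M.
    rewrite (_ : n%:R * v = (u + n%:R * v) - u); last by ring.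
    by apply: le_trans (ler_normB _ _) _; lra.
  by rewrite normrM normr_nat; lra.
apply: c0; rewrite [c]surjective_pairing; congr pair.
  by apply: (zero a.1) => n; have [] := bnd n.
by apply: (zero a.2) => n; have [] := bnd n.
Qed.

Lemma cont_horizontal x : cont (fun t : R => (x.1 + t, x.2)).
Proof.
have cid : cont (fun t : R => t) by move=> t; exact: cvg_id.
refine (@cont_pair _ _ _ (fun t => _) (fun t => _) _ _); last by continuity.
by refine (@cont_add _ _ (fun t => _) _ _ cid); continuity.
Qed.

(** The segment from [x] to its first contact with the closure of [A], that closure, and the escape
    set of [w] together form one connected set. The closure of [A] avoids [B] because [B] is
    open. *)
Lemma escapes_through_closure A B x (t0 : R) : connected A -> open B ->
  (forall p, A p -> ~ B p) -> 0 <= t0 ->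
  (forall t, 0 <= t < t0 -> ~ B (x.1 + t, x.2)) -> closure A (x.1 + t0, x.2) ->
  (exists2 w, A w & escapes B w) -> escapes B x.
Proof.
move=> cA oB AB t00 nB clA [w Aw ew].
have clB p : closure A p -> ~ B p.
  move=> clp Bp; have [q [Aq Bq]] := clp B (open_nbhs_nbhs (conj oB Bp)).
  exact: AB Aq Bq.
pose seg := (fun t : R => (x.1 + t, x.2)) @` [set t | 0 <= t <= t0].
have cseg : connected seg.
  apply: connected_image; first exact: cont_horizontal.
  apply/connected_intervalP => a b /= /andP[a0 _] /andP[_ b0] t /andP[at1 tb].
  by rewrite (le_trans a0 at1) (le_trans tb b0).
apply: (@escapes_connected (seg `|` closure A) B w) => //.
- apply: connectedU => //; last exact: connected_closure.
  by exists (x.1 + t0, x.2); split=> //; exists t0 => //=; rewrite t00 lexx.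
- move=> p [[t /andP[t1 t2] <-]|/clB//].
  have [->|tt] := eqVneq t t0; first exact: clB.
  by apply: nB; rewrite t1 lt_neqAle tt.
- by right; exact: subset_closure.
- by left; exists 0; rewrite /= ?lexx ?addr0 // -surjective_pairing.
Qed.

(** From a common point of the fillings, go right until the first contact with the closure of [A] or
    of [B]. Contact with [A] gives an escape from [B] through [A], since some point of [A] escapes
    [B]; contact with [B] is symmetric, [A] being the translate of [B] by [- c]. *)
Lemma disjoint_fills A c x : A !=set0 -> bounded2 A -> open A -> connected A ->
  c <> (0, 0) -> (forall p, A p -> ~ (translate c @` A) p) ->
  ~ escapes A x -> ~ escapes (translate c @` A) x -> False.
Proof.
move=> A0 bA oA cA c0 AB nA nB; set B := translate c @` A in AB nB.
have hc := homeo_translate c.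
have BA p : B p -> ~ A p by move=> Bp /AB.
have cB : connected B by apply: connected_image => //; case: hc.
have oB : open B.
  move=> _ [p Ap <-]; apply/nbhs_homeo => //; exact: open_nbhs_nbhs.
have bB : bounded2 B.
  case: bA => M HM; exists (M + `|c.1| + `|c.2|) => _ [p Ap <-].
  have [h1 h2] := HM p Ap; rewrite /translate /=.
  have := ler_normD p.1 c.1; have := ler_normD p.2 c.2.
  by have := normr_ge0 c.1; have := normr_ge0 c.2; split; lra.
have [w Bw ew] := translate_escapes A0 bA c0.
have [w' Aw' ew'] : exists2 y, A y & escapes B y.
  have B0 : B !=set0 by case: A0 => a Aa; exists (translate c a); exists a.
  have c0' : (- c.1, - c.2) <> (0, 0).
    by case=> /eqP; rewrite oppr_eq0 => /eqP h1 /eqP; rewrite oppr_eq0 => /eqP h2;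
      apply: c0; rewrite [c]surjective_pairing h1 h2.
  have [y [_ [p Ap <-] <-] ey] := translate_escapes B0 bB c0'.
  by exists p => //; move: ey; rewrite /translate /= !addrK -surjective_pairing.
pose T := [set t | 0 <= t /\ (A (x.1 + t, x.2) \/ B (x.1 + t, x.2))].
have lT : lbound T 0 by move=> t [].
have [t1 Tt1] : T !=set0.
  apply: contrapT => T0; apply: nA.
  exists ((fun t : R => (x.1 + t, x.2)) @` [set t | 0 <= t]); split.
  - apply: connected_image; first exact: cont_horizontal.
    by apply/connected_intervalP => a b /= a_0 b_0 t /andP[at1 _]; exact: le_trans at1.
  - by exists 0; rewrite /= ?lexx ?addr0 // -surjective_pairing.
  - by move=> _ [t /= t_0 <-] At; apply: T0; exists t; split=> //; left.
  - move=> [M HM]; have M0 : 0 <= M.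
      have [|/(le_trans (normr_ge0 _))//] := HM (x.1 + 0, x.2).
      by exists 0; rewrite /= ?lexx.
    have x_0 := normr_ge0 x.1; have := ler_norm (- x.1); rewrite normrN => x_1.
    have [|+ _] := HM (x.1 + (M + `|x.1| + 1), x.2).
      by exists (M + `|x.1| + 1) => //=; lra.
    by rewrite /= ler_norml => /andP[_]; lra.
have hT : has_inf T by split; [exists t1|exists 0].
pose t0 := inf T.
have t00 : 0 <= t0 by apply: lb_le_inf => //; exists t1.
have before t : 0 <= t < t0 -> ~ (A (x.1 + t, x.2) \/ B (x.1 + t, x.2)).
  move=> /andP[t_0 tt] ABt; have : t0 <= t by apply: ge_inf; [exists 0|split].
  by rewrite leNgt tt.
have : closure (A `|` B) (x.1 + t0, x.2).
  move=> N nN; have nN' : nbhs t0 ((fun t : R => (x.1 + t, x.2)) @^-1` N) by exact: cont_horizontal nN.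
  have [e /= e0 eN] := nN'.
  have [t [t_0 ABt] te] := inf_adherent e0 hT.
  exists (x.1 + t, x.2); split; first by case: ABt; [left|right].
  apply: eN; rewrite /= distrC ger0_norm ?subr_ge0; first by rewrite ltrBlDl.
  by apply: ge_inf; [exists 0|split].
rewrite closureU => -[clA|clB].
  apply: nB; apply: (@escapes_through_closure A B x t0) => //; last by exists w'.
  by move=> t /before nt Bt; apply: nt; right.
apply: nA; apply: (@escapes_through_closure B A x t0) => //; last by exists w.
by move=> t /before nt At; apply: nt; left.
Qed.

End NestedFills.

(** * The limit set *)

Section LimitSet.
Variables (R : realType) (z : R * R).
Implicit Types (p q x y : R * R) (A L : set (R * R)).

(** Squared, so that it is polynomial. The thresholds [eta], [rho] and [delta] are thus squares of
    lengths, and the triangle inequality costs a factor 2. *)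
Definition dist2 x y : R := cnorm2 (csub x y).

Lemma dist2xx x : dist2 x x = 0.
Proof. by rewrite /dist2 /cnorm2 /csub /= !subrr expr0n addr0. Qed.

Lemma dist2C x y : dist2 x y = dist2 y x.
Proof. by rewrite /dist2 /cnorm2 /csub /=; ring. Qed.

Lemma dist2_ge0 x y : 0 <= dist2 x y.
Proof. by rewrite /dist2 /cnorm2 addr_ge0 ?sqr_ge0. Qed.

Lemma dist2_eq0 x y : dist2 x y = 0 -> x = y.
Proof.
move/eqP; rewrite /dist2 /cnorm2 paddr_eq0 ?sqr_ge0 // !sqrf_eq0 !subr_eq0.
by case: x y => a b [c d] /= /andP[/eqP-> /eqP->].
Qed.

Lemma dist2_triangle y x w : dist2 x w <= 2 * (dist2 x y + dist2 y w).
Proof.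
rewrite /dist2 /cnorm2 /csub /= -subr_ge0.
rewrite (_ : _ - _ = (x.1 + w.1 - 2 * y.1) ^+ 2 + (x.2 + w.2 - 2 * y.2) ^+ 2); last by ring.
by rewrite addr_ge0 ?sqr_ge0.
Qed.

Lemma cont_dist2 y : cont (fun x => dist2 x y).
Proof. by rewrite /dist2 /cnorm2 /csub /=; continuity. Qed.

Lemma cont_dist2_fun (f g : R * R -> R * R) : cont f -> cont g ->
  cont (fun xy : (R * R) * (R * R) => dist2 (f xy.1) (g xy.2)).
Proof.
move=> cf cg.
have c1 : cont (fun xy : (R * R) * (R * R) => f xy.1) by apply: cont_comp => //; exact: cont_fst.
have c2 : cont (fun xy : (R * R) * (R * R) => g xy.2) by apply: cont_comp => //; exact: cont_snd.
have c11 := cont_comp (@cont_fst R R) c1; have c12 := cont_comp (@cont_snd R R) c1.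
have c21 := cont_comp (@cont_fst R R) c2; have c22 := cont_comp (@cont_snd R R) c2.
by rewrite /dist2 /cnorm2 /csub /=; continuity.
Qed.

Lemma min_dist2 (f g : R * R -> R * R) A B : cont f -> cont g -> compact A -> compact B ->
  A !=set0 -> B !=set0 ->
  exists a b, [/\ A a, B b & forall x y, A x -> B y -> dist2 (f a) (g b) <= dist2 (f x) (g y)].
Proof.
move=> cf cg cA cB [a0 Aa0] [b0 Bb0].
have AB0 : (A `*` B) !=set0 by exists (a0, b0).
have [[a b]] := compact_EVT_min AB0 (compact_setX cA cB)
  (continuous_subspaceT (cont_dist2_fun cf cg)).
rewrite inE => -[/= Aa Bb] H; exists a, b; split=> // x y Ax By.
by apply: (H (x, y)); rewrite inE.
Qed.

Lemma dist2_fgen x y : dist2 (fgen z x) (fgen z y) = cnorm2 z * dist2 x y.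
Proof. by rewrite /dist2 /cnorm2 /fgen /csub /cmul /=; ring. Qed.

Lemma dist2_ggen x y : dist2 (ggen z x) (ggen z y) = cnorm2 z * dist2 x y.
Proof. by rewrite /dist2 /cnorm2 /ggen /cadd /csub /cmul /=; ring. Qed.

Definition gshift : R * R := (1 - z.1, - z.2).

Lemma ggen_translate x : ggen z x = translate gshift (fgen z x).
Proof. by rewrite /ggen /fgen /gshift /translate /cadd /csub /cmul /cone /=; congr pair => /=; ring. Qed.

Lemma homeo_fgen : 0 < cnorm2 z -> homeo (fgen z).
Proof.
move=> z0; have n0 : cnorm2 z != 0 by rewrite lt0r_neq0.
have E1 : cnorm2 z = z.1 * z.1 + z.2 * z.2 by rewrite /cnorm2 !expr2.
split; first by rewrite /fgen /cmul; continuity.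
exists (fun y => ((z.1 * y.1 + z.2 * y.2) / cnorm2 z, (z.1 * y.2 - z.2 * y.1) / cnorm2 z)).
split; first by continuity.
- move=> [a b]; rewrite /fgen /cmul /=; congr pair.
    by rewrite -[RHS](mulfK n0) E1; congr (_ / _); ring.
  by rewrite -[RHS](mulfK n0) E1; congr (_ / _); ring.
- move=> [a b]; rewrite /fgen /cmul /=; congr pair.
    by rewrite -[RHS](mulfK n0) !mulrA -mulrBl E1; congr (_ / _); ring.
  by rewrite -[RHS](mulfK n0) !mulrA -mulrDl E1; congr (_ / _); ring.
Qed.

Lemma homeo_ggen : 0 < cnorm2 z -> homeo (ggen z).
Proof.
move=> z0; have -> : ggen z = (fun x => translate gshift (fgen z x)).
  by apply/funext => x; exact: ggen_translate.
by apply: homeo_comp; [exact: homeo_translate|exact: homeo_fgen].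
Qed.

Section Fixed.
Variable L : set (R * R).
Hypothesis z1 : 0 < cnorm2 z < 1.
Hypothesis LP : is_limit_set z L.

Let L0 : L !=set0. Proof. by case: LP. Qed.
Let cL : compact L. Proof. by case: LP => _ []. Qed.
Let LE : L = fgen z @` L `|` ggen z @` L. Proof. by case: LP => _ []. Qed.

Lemma limit_fgen x : L x -> L (fgen z x).
Proof. by move=> Lx; rewrite LE; left; exists x. Qed.

Lemma limit_ggen x : L x -> L (ggen z x).
Proof. by move=> Lx; rewrite LE; right; exists x. Qed.

Lemma limit_cases x : L x -> (exists2 y, L y & x = fgen z y) \/ (exists2 y, L y & x = ggen z y).
Proof. by rewrite {1}LE => -[[y Ly <-]|[y Ly <-]]; [left|right]; exists y. Qed.

Definition inL : pred (R * R) := fun x => `[< L x >].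
Definition close (eta : R) : rel (R * R) := fun x y => dist2 x y <= eta.

Lemma close_sym eta : symmetric (close eta).
Proof. by move=> x y; rewrite /close dist2C. Qed.

Lemma joined_map (h : R * R -> R * R) (eta eta' : R) x y :
  (forall u, L u -> L (h u)) -> (forall u v, dist2 u v <= eta -> dist2 (h u) (h v) <= eta') ->
  joined (close eta) inL x y -> joined (close eta') inL (h x) (h y).
Proof.
move=> hL hd [p [pp lp pL]]; exists (map h p); split.
- by rewrite path_map; apply: sub_path pp => u v; exact: hd.
- by rewrite last_map lp.
- by rewrite -map_cons all_map; apply: sub_all pL => u /asboolP Lu; apply/asboolP/hL.
Qed.

Lemma joined_le (eta eta' : R) x y : eta <= eta' ->
  joined (close eta) inL x y -> joined (close eta') inL x y.
Proof.
move=> le [p [pp lp pL]]; exists p; split=> //.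
by apply: sub_path pp => u v /le_trans; apply.
Qed.

Lemma limit_bound : exists2 M, 0 <= M & forall x y, L x -> L y -> dist2 x y <= M.
Proof.
have [M HM] := compact_bounded2 cL; have [l Ll] := L0.
have M0 : 0 <= M by have [/(le_trans (normr_ge0 _))] := HM l Ll.
exists (8 * M ^+ 2) => [|x y /HM[x1 x2] /HM[y1 y2]]; first by rewrite mulr_ge0 ?sqr_ge0.
have sq (a b : R) : `|a| <= M -> `|b| <= M -> (a - b) ^+ 2 <= 4 * M ^+ 2.
  rewrite !ler_norml => /andP[? ?] /andP[? ?]; nra.
by rewrite /dist2 /cnorm2 /csub /=; have := sq _ _ x1 y1; have := sq _ _ x2 y2; lra.
Qed.

Lemma expn_small (M eta : R) : 0 <= M -> 0 < eta -> exists n, cnorm2 z ^+ n * M < eta.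
Proof.
move=> M0 eta0; have M1 : 0 < M + 1 by lra.
have [c0 c1] := andP z1.
have cvg0 : (fun n => cnorm2 z ^+ n) @ \oo --> (0 : R).
  by apply: cvg_expr; rewrite ger0_norm // ltW.
have : \forall n \near \oo, cnorm2 z ^+ n < eta / (M + 1).
  by apply: (cvgr_lt 0 cvg0); rewrite divr_gt0.
move=> [n _ /(_ n (leqnn n)) /= ]; rewrite ltr_pdivlMr // => lt; exists n.
by apply: le_lt_trans lt; rewrite mulrDr mulr1 lerDl exprn_ge0 // ltW.
Qed.

(* Short hops: iterating the two contractions shrinks all the steps of a chain
   except the hop from f(L) to g(L). *)
Lemma short_hops (eta : R) a b : 0 < eta -> L a -> L b ->
  dist2 (fgen z a) (ggen z b) <= eta -> forall x y, L x -> L y -> joined (close eta) inL x y.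
Proof.
move=> eta0 La Lb hop; have [M M0 HM] := limit_bound.
have [n1 n2] : 0 <= cnorm2 z /\ cnorm2 z < 1 by case/andP: z1 => /ltW.
have mul_le (e u : R) : u <= e -> cnorm2 z * u <= Num.max (cnorm2 z * e) eta.
  by move=> ue; rewrite le_max ler_wpM2l.
have step e : (forall x y, L x -> L y -> joined (close e) inL x y) ->
    forall x y, L x -> L y -> joined (close (Num.max (cnorm2 z * e) eta)) inL x y.
  move=> IH; set e' := Num.max _ _.
  have ff u v : L u -> L v -> joined (close e') inL (fgen z u) (fgen z v).
    move=> Lu Lv; apply: (@joined_map (fgen z) e) (IH _ _ Lu Lv); first exact: limit_fgen.
    by move=> s t st; rewrite dist2_fgen; exact: mul_le.
  have gg u v : L u -> L v -> joined (close e') inL (ggen z u) (ggen z v).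
    move=> Lu Lv; apply: (@joined_map (ggen z) e) (IH _ _ Lu Lv); first exact: limit_ggen.
    by move=> s t st; rewrite dist2_ggen; exact: mul_le.
  have fg u v : L u -> L v -> joined (close e') inL (fgen z u) (ggen z v).
    move=> Lu Lv; apply: joined_trans (ff u a Lu La) _.
    apply: (@joined_trans _ _ _ (ggen z b)); last exact: gg.
    apply: joined1; first by apply/asboolP/limit_fgen.
      by apply/asboolP/limit_ggen.
    by rewrite /close le_max hop orbT.
  move=> x y /limit_cases[] [x' Lx ->] /limit_cases[] [y' Ly ->].
  - exact: ff.
  - exact: fg.
  - by apply: joined_sym; [exact: close_sym|exact: fg].
  - exact: gg.
have iter n : forall x y, L x -> L y ->
    joined (close (Num.max (cnorm2 z ^+ n * M) eta)) inL x y.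
  elim: n => [|n IH] x y Lx Ly.
    apply: joined1; [exact/asboolP|exact/asboolP|].
    by rewrite /close expr0 mul1r le_max HM.
  apply: joined_le (step _ IH x y Lx Ly).
  rewrite ge_max; apply/andP; split; rewrite le_max; last by rewrite lexx orbT.
  case: (lerP (cnorm2 z ^+ n * M) eta) => _; apply/orP; [right|left].
    by rewrite ler_piMl // ltW.
  by rewrite exprS -mulrA lexx.
have [n /ltW nM] := expn_small M0 eta0.
move=> x y Lx Ly; apply: joined_le (iter n x y Lx Ly).
by rewrite ge_max nM lexx.
Qed.

(** The pieces of a separation would be compact, hence at positive distance; a chain with smaller
    steps cannot pass from one to the other. *)
Lemma connected_limit_set a b : L a -> L b -> fgen z a = ggen z b -> connected L.
Proof.
move=> La Lb ab; apply/connectedP => E [E0 EL [s1 s2]].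
have cE i : compact (E i).
  have -> : E i = L `&` closure (E i).
    apply/seteqP; split=> [x Ex|x].
      by split; [rewrite EL; case: i Ex; [right|left]|exact: subset_closure].
    rewrite EL => -[[Ex|Ex] cx]; case: i cx => // cx; exfalso.
      by have : (E false `&` closure (E true)) x by []; rewrite s2.
    by have : (closure (E false) `&` E true) x by []; rewrite s1.
  by apply: compact_closedI => //; exact: closed_closure.
have cid : cont (fun x : R * R => x) by exact: cont_id.
have [u [v [Eu Ev uv]]] := min_dist2 cid cid (cE false) (cE true) (E0 false) (E0 true).
have Lu : L u by rewrite EL; left.
have Lv : L v by rewrite EL; right.
have d0 : 0 < dist2 u v.
  rewrite lt_neqAle dist2_ge0 andbT eq_sym; apply/eqP => /dist2_eq0 E1.
  have : (closure (E false) `&` E true) v by split=> //; apply: subset_closure; rewrite -E1.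
  by rewrite s1.
have hop : dist2 (fgen z a) (ggen z b) <= dist2 u v / 2.
  by rewrite ab dist2xx divr_ge0 // dist2_ge0.
have ch := short_hops (divr_gt0 d0 (ltr0Sn _ 1)) La Lb hop Lu Lv.
have nv : ~~ `[< E false v >].
  apply/negP => /asboolP Ev'.
  have : (closure (E false) `&` E true) v by split=> //; exact: subset_closure.
  by rewrite s1.
have [|x [y [ux xy /asboolP Ly /asboolP ny]]] := joined_exit (B := fun x => `[< E false x >]) ch _ nv.
  exact/asboolP.
have [_ /andP[_ /asboolP Ex]] := joined_mem ux.
have Ey : E true y by move: Ly; rewrite EL => -[].
have := uv x y Ex Ey; have := xy; rewrite /close => le1 le2.
by have := le_trans le2 le1; lra.
Qed.

Definition thick (rho : R) : set (R * R) := [set x | exists2 l, L l & dist2 x l < rho].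

Lemma star_connected x0 A : A x0 -> (forall x t, A x -> 0 <= t <= 1 ->
  A (x0.1 + t * (x.1 - x0.1), x0.2 + t * (x.2 - x0.2))) -> connected A.
Proof.
move=> A0 star.
pose S x := (fun t : R => (x0.1 + t * (x.1 - x0.1), x0.2 + t * (x.2 - x0.2))) @` `[0, 1]%classic.
rewrite (_ : A = \bigcup_(x in A) S x).
  apply: bigcup_connected => [|x Ax].
    exists x0 => x Ax; exists 0 => /=; first by rewrite in_itv /= lexx ler01.
    by rewrite !mul0r !addr0 -surjective_pairing.
  apply: connected_image; last exact: segment_connected.
  by continuity.
apply/seteqP; split=> [x Ax|x [y Ay [t /=]]].
  exists x => //; exists 1 => /=; first by rewrite in_itv /= lexx ler01.
  by rewrite !mul1r !(addrC _ (_ - _)) !subrK -surjective_pairing.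
by rewrite in_itv /= => t1 <-; exact: star.
Qed.

Lemma connected_ball l (rho : R) : 0 < rho -> connected [set x | dist2 x l < rho].
Proof.
move=> rho0; apply: (@star_connected l) => [|x t /=]; first by rewrite /= dist2xx.
rewrite /dist2 /cnorm2 /csub /= => xl /andP[t0 t1].
rewrite (_ : _ + _ = t ^+ 2 * ((x.1 - l.1) ^+ 2 + (x.2 - l.2) ^+ 2)); last by ring.
apply: le_lt_trans xl; rewrite ler_piMl ?addr_ge0 ?sqr_ge0 //.
by rewrite expr_le1.
Qed.

Lemma open_thick (rho : R) : open (thick rho).
Proof.
move=> x [l Ll xl]; have := cont_nbhs_lt (@cont_dist2 l) xl.
by apply: filterS => q ql; exists l.
Qed.

Lemma bounded_thick (rho : R) : 0 < rho -> bounded2 (thick rho).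
Proof.
move=> rho0; have [M HM] := compact_bounded2 cL; exists (M + 1 + rho) => x [l Ll].
have [l1 l2] := HM l Ll; rewrite /dist2 /cnorm2 /csub /= => xl.
have sq (u v : R) : `|v| <= M -> (u - v) ^+ 2 < rho -> `|u| <= M + 1 + rho.
  by rewrite !ler_norml => /andP[? ?] ?; apply/andP; split; nra.
have := sqr_ge0 (x.1 - l.1); have := sqr_ge0 (x.2 - l.2).
by split; [apply: (sq _ l.1)|apply: (sq _ l.2)] => //; lra.
Qed.

(** For squared lengths, [eta < 4 * rho] says that the midpoint of a step lies in the balls around
    both of its ends. *)
Lemma connected_thick (eta rho : R) : eta < 4 * rho -> 0 < rho ->
  (forall x y, L x -> L y -> joined (close eta) inL x y) -> connected (thick rho).
Proof.
move=> er rho0 ch; have [l0 Ll0] := L0.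
pose Ball l := [set x | dist2 x l < rho].
have grow (p : seq (R * R)) l : L l -> path (close eta) l p -> all inL (l :: p) ->
    exists A, [/\ connected A, Ball l `<=` A, Ball (last l p) `<=` A & A `<=` thick rho].
  elim: p l => [|y p IH] l Ll /=.
    move=> _ _; exists (Ball l); split=> //; first exact: connected_ball.
    by move=> x xl; exists l.
  move=> /andP[ly pp] /and3P[_ /asboolP Ly pL].
  have [|A [cA yA lA AN]] := IH y Ly pp; first by rewrite /= pL andbT; apply/asboolP.
  exists (Ball l `|` A); split.
  - apply: connectedU => //; last exact: connected_ball.
    exists ((l.1 + y.1) / 2, (l.2 + y.2) / 2).
    have mid : dist2 l y / 4 < rho.
      by rewrite ltr_pdivrMr // mulrC; apply: le_lt_trans er.
    split; last apply: yA; apply: le_lt_trans mid; rewrite le_eqVlt; apply/orP; left;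
      by rewrite /dist2 /cnorm2 /csub /=; apply/eqP; field.
  - by left.
  - by move=> x /lA; right.
  - by move=> x [xl|/AN//]; exists l.
pose P := [set A : set (R * R) | [/\ connected A, A l0 & A `<=` thick rho]].
rewrite (_ : thick rho = \bigcup_(A in P) A).
  by apply: bigcup_connected => [|A []//]; exists l0 => A [].
apply/seteqP; split=> [x [l Ll xl]|x [A [_ _ AN] /AN//]].
have [p [pp lp pL]] := ch l0 l Ll0 Ll.
have [A [cA lA llA AN]] := grow p l0 Ll0 pp pL.
exists A; first by split=> //; apply: lA; rewrite /Ball /mkset dist2xx.
by apply: llA; rewrite lp.
Qed.

End Fixed.
End LimitSet.

(** * The two implications *)

Section Main.
Variables (R : realType) (z : R * R) (L : set (R * R)).
Implicit Types (p q x y : R * R).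
Hypothesis z1 : 0 < cnorm2 z < 1.
Hypothesis LP : is_limit_set z L.

Lemma thick_ball (rho rho' : R) : 0 < rho' -> rho' < rho ->
  exists2 eps, 0 < eps & forall p q, thick L rho' p ->
    `|q.1 - p.1| <= eps -> `|q.2 - p.2| <= eps -> thick L rho q.
Proof.
(* Each coordinate raises the squared distance by at most [(2 * (1 + rho') + 1) * eps]; [k] is twice
   this coefficient. *)
move=> r0 rr; pose k := 4 * (1 + rho') + 2; have k0 : 0 < k by rewrite /k; lra.
pose eps := Num.min 1 ((rho - rho') / k).
have e0 : 0 < eps by rewrite lt_min ltr01 divr_gt0 // subr_gt0.
have e1 : eps <= 1 by rewrite ge_min lexx.
have e2 : eps * k <= rho - rho' by rewrite -ler_pdivlMr // ge_min lexx orbT.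
exists eps => // p q [l Ll pl] q1 q2; exists l => //.
move: pl; rewrite /dist2 /cnorm2 /csub /=.
have -> : q.1 - l.1 = (p.1 - l.1) + (q.1 - p.1) by ring.
have -> : q.2 - l.2 = (p.2 - l.2) + (q.2 - p.2) by ring.
move: (p.1 - l.1) (p.2 - l.2) (q.1 - p.1) (q.2 - p.2) q1 q2 => u1 u2 d1 d2 h1 h2 uu.
have sq (u d : R) : u ^+ 2 < rho' -> `|d| <= eps ->
    (u + d) ^+ 2 <= u ^+ 2 + (2 * (1 + rho') + 1) * eps.
  move=> u2r de; have de2 : d ^+ 2 <= eps.
    rewrite -real_normK ?num_real // expr2; apply: le_trans (_ : eps * 1 <= _); last by rewrite mulr1.
    by apply: ler_pM => //; apply: le_trans de e1.
  have un : `|u| <= 1 + rho' by rewrite ler_norml; apply/andP; split; nra.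
  have ud : u * d <= (1 + rho') * eps.
    by apply: le_trans (ler_norm _) _; rewrite normrM ler_pM.
  by rewrite sqrrD mulr2n; lra.
have := sqr_ge0 u1; have := sqr_ge0 u2 => s2 s1.
have t1 : u1 ^+ 2 < rho' by lra.
have t2 : u2 ^+ 2 < rho' by lra.
by have := sq _ _ t1 h1; have := sq _ _ t2 h2; move: e2; rewrite /k; lra.
Qed.

Lemma thick_image (h : R * R -> R * R) (rho : R) :
  (forall x, L x -> L (h x)) -> (forall x y, dist2 (h x) (h y) = cnorm2 z * dist2 x y) ->
  h @` thick L rho `<=` thick L (cnorm2 z * rho).
Proof.
move=> hL hd _ [x [l Ll xl] <-]; exists (h l); first exact: hL.
by rewrite hd ltr_pM2l //; case/andP: z1.
Qed.

Lemma disconnected_schottky : ~ connected L -> schottky z.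
Proof.
move=> ncL; have [c0 c1] := andP z1; have [L0 [cL LE]] := LP.
have hf := homeo_fgen c0; have hg := homeo_ggen c0.
have [cf _] := hf; have [cg _] := hg.
have [a [b [La Lb ab]]] := min_dist2 cf cg cL cL L0 L0.
pose delta := dist2 (fgen z a) (ggen z b).
have d0 : 0 < delta.
  rewrite lt_neqAle dist2_ge0 andbT eq_sym; apply/eqP => /dist2_eq0 E.
  by apply: ncL; exact: (connected_limit_set z1 LP La Lb E).
have ch := short_hops z1 LP d0 La Lb (lexx delta).
(* With this [rho], the sets [f(U)] and [g(U)] stay within half the distance of [f(L)] and [g(L)],
   hence are disjoint. As [cnorm2 z < 1], [rho] exceeds [delta / 4], which leaves room for
   [rho']. *)
have [rho rhoE] : exists rho, 4 * (cnorm2 z * rho) = delta.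
  by exists (delta / (4 * cnorm2 z)); field; rewrite lt0r_neq0.
have rho1 : delta < 4 * rho by nra.
pose rho' := (delta / 4 + rho) / 2.
have [r1 r2] : delta < 4 * rho' /\ rho' < rho by rewrite /rho'; lra.
have [rp rp'] : 0 < rho /\ 0 < rho' by lra.
set K := thick L rho'; set U := thick L rho.
have KU : K `<=` U by move=> x [l Ll xl]; exists l => //; apply: lt_trans r2.
have fUK : fgen z @` U `<=` K.
  move=> y /(thick_image (limit_fgen LP) (dist2_fgen z))[l Ll yl].
  by exists l => //; apply: lt_trans yl _; lra.
have gUK : ggen z @` U `<=` K.
  move=> y /(thick_image (limit_ggen LP) (dist2_ggen z))[l Ll yl].
  by exists l => //; apply: lt_trans yl _; lra.
have K0 : K !=set0 by case: L0 => l Ll; exists l; exists l => //; rewrite dist2xx.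
have [eps e0 eKU] := thick_ball rp' r2.
have cK : connected K := connected_thick LP r1 rp' ch.
have cU : connected U := connected_thick LP rho1 rp ch.
have [D [dD KD DU Dout]] := disk_between e0 K0 (@open_thick R L rho') cK (bounded_thick LP rp') eKU.
(* If [h x] were not interior to [D], it would escape the interior of [D], which contains [K] and so
   [h(U)]. Pulled back by [h], this lets [x] escape [U], although [D] lies in the filling of [U]. *)
have img h : homeo h -> h @` U `<=` K -> h @` D `<=` interior D.
  move=> hh hUK _ [x Dx <-]; apply: contrapT => /Dout nx; apply: (DU x Dx).
  apply: (escapes_homeo_inv hh); apply: escapes_sub nx.
  by apply: subset_trans KD.
exists D; split=> //; split; first exact: img.
split; first exact: img.
apply/seteqP; split=> // y [[u Du <-] [v Dv uv]].
have gf : ggen z @` U = translate (gshift z) @` (fgen z @` U).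
  by rewrite image_comp; apply: eq_imagel => x _; rewrite /= ggen_translate.
apply: (@disjoint_fills R (fgen z @` U) (gshift z) (fgen z u)).
- by case: L0 => l Ll; exists (fgen z l); exists l => //; exists l => //; rewrite dist2xx.
- have [M HM] := bounded_thick LP rp'; exists M => p /fUK; exact: HM.
- by move=> _ [x Ux <-]; apply/nbhs_homeo => //; exact: (open_thick Ux).
- exact: connected_image.
- case=> E1 E2; move: c1; rewrite /cnorm2.
  have -> : z.1 = 1 by lra.
  by have -> : z.2 = 0; [lra|rewrite expr1n expr0n addr0 ltxx].
- move=> p; rewrite -gf => -[x [l Ll xl] <-] [x' [l' Ll' xl'] E].
  have t0 : delta <= dist2 (fgen z l) (ggen z l') := ab l l' Ll Ll'.
  have t1 := dist2_triangle (fgen z x) (fgen z l) (ggen z l').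
  have t2 : dist2 (fgen z l) (fgen z x) < cnorm2 z * rho.
    by rewrite dist2C dist2_fgen ltr_pM2l.
  have t3 : dist2 (fgen z x) (ggen z l') < cnorm2 z * rho.
    by rewrite -E dist2_ggen ltr_pM2l.
  by lra.
- by move=> /(escapes_homeo_inv hf); exact: DU.
- by rewrite -gf -uv => /(escapes_homeo_inv hg); exact: DU.
Qed.

Lemma schottky_disconnected : schottky z -> ~ connected L.
Proof.
move=> [D [[phi [cphi [phi_inj DE]]] [fD [gD fgD]]]] cLn.
have [c0 c1] := andP z1; have [L0 [cL LE]] := LP.
have cdisk : compact (@closed_unit_disk R).
  apply: (@subclosed_compact _ _ [set p : R * R | `|p.1| <= 1 /\ `|p.2| <= 1]).
  - rewrite (_ : @closed_unit_disk R = (@cnorm2 R) @^-1` [set t | t <= 1]) //.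
    apply: preimage_closed; last exact: closed_le.
    by move=> p _; apply: (_ : cont (@cnorm2 R)); rewrite /cnorm2; continuity.
  - exact: compact_square.
  - move=> p Dp; split; first exact: closed_unit_disk_norm.
  by apply: (@closed_unit_disk_norm R (p.2, p.1)); move: Dp; rewrite /closed_unit_disk /cnorm2 /= addrC.
have cD : compact D by rewrite DE; exact: continuous_compact.
have clD : closed D by apply: compact_closed => //; exact: norm_hausdorff.
have D0 : D !=set0.
  by exists (phi (0, 0)); rewrite DE; exists (0, 0) => //; rewrite /closed_unit_disk /cnorm2 /= expr0n addr0 ler01.
have fDD x : D x -> D (fgen z x) by move=> Dx; apply: interior_subset; apply: fD; exists x.
have gDD x : D x -> D (ggen z x) by move=> Dx; apply: interior_subset; apply: gD; exists x.
(* A point of [L] is the image of a point of [L] under a word of length [n], which preserves [D];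
   its squared distance to [D] is therefore at most [cnorm2 z ^+ n * M], and [D] is compact. *)
have LD : L `<=` D.
  have [x0 D0x] := D0.
  have [l1 _ HM] := compact_EVT_max L0 cL (continuous_subspaceT (@cont_dist2 R x0)).
  pose M := dist2 l1 x0; have M0 : 0 <= M by exact: dist2_ge0.
  have near_D n : forall l, L l -> exists2 d, D d & dist2 l d <= cnorm2 z ^+ n * M.
    elim: n => [|n IH] l Ll.
      by exists x0 => //; rewrite expr0 mul1r; apply: HM; rewrite inE.
    case: (limit_cases LP Ll) => -[l' Ll' ->]; have [d Dd ld] := IH l' Ll'.
      exists (fgen z d); first exact: fDD.
      by rewrite dist2_fgen exprS -mulrA ler_pM2l.
    exists (ggen z d); first exact: gDD.
    by rewrite dist2_ggen exprS -mulrA ler_pM2l.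
  move=> l Ll; apply: contrapT => nDl.
  have [d Dd ld] : exists2 d, D d & forall y, D y -> dist2 l d <= dist2 l y.
    have [d Dd H] := compact_EVT_max D0 cD (continuous_subspaceT (cont_opp (@cont_dist2 R l))).
    exists d; first by move: Dd; rewrite inE.
    by move=> y Dy; rewrite !(dist2C l) -lerN2; apply: H; rewrite inE.
  have ld0 : 0 < dist2 l d.
    rewrite lt_neqAle dist2_ge0 andbT eq_sym; apply/eqP => /dist2_eq0 E.
    by apply: nDl; rewrite E.
  have [n nM] := expn_small z1 M0 ld0.
  have [y Dy ly] := near_D n l Ll.
  by have := le_lt_trans (le_trans (ld y Dy) ly) nM; rewrite ltxx.
have [l Ll] := L0.
have clf (h : R * R -> R * R) : cont h -> closed (h @` L).
  move=> ch; apply: compact_closed; first exact: norm_hausdorff.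
  by apply: continuous_compact => //; exact: continuous_subspaceT.
have [cf _] := homeo_fgen c0; have [cg _] := homeo_ggen c0.
have disj x : (fgen z @` L) x -> ~ (ggen z @` L) x.
  move=> [u Lu <-] [v Lv uv].
  have : (fgen z @` D `&` ggen z @` D) (fgen z u).
    by split; [exists u => //; exact: LD|exists v => //; exact: LD].
  by rewrite fgD.
(* [f(L)] is nonempty and closed, and it is relatively open as the complement of [g(L)] in [L];
   connectedness would make it all of [L]. *)
have fL : fgen z @` L = L.
  apply: cLn.
  - by exists (fgen z l); exists l.
  - exists (~` (ggen z @` L)); first by apply: closed_openC; exact: clf.
    apply/seteqP; split=> [x fx|x [Lx ngx]].
      by split; [rewrite LE; left|exact: disj].
    by move: Lx; rewrite {1}LE => -[].
  - exists (fgen z @` L); first exact: clf.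
    apply/seteqP; split=> [x fx|x [_]//].
    by split=> //; rewrite LE; left.
apply: (disj (ggen z l)); last by exists l.
by rewrite fL; exact: (limit_ggen LP Ll).
Qed.

End Main.

Theorem theorem5p2p3 (R : realType) (z : R * R) (L : set (R * R)) :
  punctured_disk z -> is_limit_set z L ->
  (~ connected L <-> schottky z).
Proof.
move=> z1 LP; split; first exact: disconnected_schottky.
exact: schottky_disconnected.
Qed.
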